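(* Let $n\geqslant 2$ and let $V$ be an irreducible complex representation of $\mathrm{SU}_n$. If $\dim_{\mathbb{C}} V\leqslant n^2-1$ (the dimension of the isospectral model) and $V$ contains a non-zero $H$-fixed vector, then $V$ is isomorphic either to the trivial representation or to the (complexified traceless) isospectral model $\mathrm{Her}_n^{tr=0}(\mathbb{R})\otimes_{\mathbb{R}}\mathbb{C}$.
   Context: $H\subseteq\mathrm{SU}_n$ is the subgroup of diagonal matrices. $\mathrm{Her}_n^{tr=0}(\mathbb{R})$ is the real vector space of traceless complex Hermitian $n\times n$ matrices with $\mathrm{SU}_n$-action $A\cdot T=ATA^*$; it has real dimension $n^2-1$, and is called the (traceless) isospectral model. Representations are finite-dimensional. *)

(* Defs.v *)
From HB Require Import structures.
From mathcomp Require Import all_boot all_order all_algebra.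
From mathcomp Require Import all_classical all_reals all_analysis.
From mathcomp Require Import complex.
Set Implicit Arguments.
Unset Strict Implicit.
Unset Printing Implicit Defensive.
Import Order.TTheory GRing.Theory Num.Theory.
Import numFieldNormedType.Exports.
Local Open Scope classical_set_scope.
Local Open Scope ring_scope.
Local Open Scope sesquilinear_scope.
Local Open Scope complex_scope.

(* R[i] is a numClosedFieldType, hence carries the topology of its modulus;
   the instance is not found automatically for the concrete carrier R[i]. *)
HB.instance Definition _ (R : realType) :=
  PseudoPointedMetric.copy R[i] ((R[i] : numClosedFieldType)^o).

Section Groups.
Variables (R : realType) (n : nat).

Record SU := MkSU {
  SU_mx :> 'M[R[i]]_n;
  SU_mxP : (SU_mx \is unitarymx) && (\det SU_mx == 1) }.

HB.instance Definition _ := [isSub for SU_mx].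
HB.instance Definition _ := [Choice of SU by <:].

(* Subspace topology from 'M[R[i]]_n. *)
HB.instance Definition _ := Topological.copy SU (initial_topology SU_mx).

Lemma SU_adjK (A : SU) : A^t* *m A = 1%:M.
Proof.
by case: A => A /= /andP[/unitarymxP uA _]; exact: mulmx1C.
Qed.

Lemma SU1_subproof :
  ((1%:M : 'M[R[i]]_n) \is unitarymx) && (\det (1%:M : 'M[R[i]]_n) == 1).
Proof.
by rewrite det1 eqxx andbT; apply/unitarymxP; rewrite trmx1 map_mx1 mulmx1.
Qed.

Lemma SUM_subproof (A B : SU) :
  (A *m B \is unitarymx) && (\det (A *m B) == 1).
Proof.
case: A B => [A /= /andP[uA /eqP dA]] [B /= /andP[uB /eqP dB]].
by rewrite mul_unitarymx // det_mulmx dA dB mulr1 eqxx.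
Qed.

Lemma SUV_subproof (A : SU) : (A^t* \is unitarymx) && (\det (A^t*) == 1).
Proof.
apply/andP; split; first by apply/unitarymxP; rewrite trmxCK SU_adjK.
case: A => [A /= /andP[_ /eqP dA]].
by rewrite det_map_mx det_tr dA rmorph1.
Qed.

Definition SU_one := MkSU SU1_subproof.
Definition SU_mul A B := MkSU (SUM_subproof A B).
Definition SU_inv A := MkSU (SUV_subproof A).

Lemma SU_mulA : associative SU_mul.
Proof. by move=> A B C; apply/val_inj; rewrite /= mulmxA. Qed.
Lemma SU_mul1 : left_id SU_one SU_mul.
Proof. by move=> A; apply/val_inj; rewrite /= mul1mx. Qed.
Lemma SU_mulr1 : right_id SU_one SU_mul.
Proof. by move=> A; apply/val_inj; rewrite /= mulmx1. Qed.
Lemma SU_mulV : left_inverse SU_one SU_inv SU_mul.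
Proof. by move=> A; apply/val_inj; rewrite /= SU_adjK. Qed.
Lemma SU_mulrV : right_inverse SU_one SU_inv SU_mul.
Proof. by move=> A; apply/val_inj => /=; apply: mulmx1C; rewrite SU_adjK. Qed.

HB.instance Definition _ :=
  isGroup.Build SU SU_mulA SU_mul1 SU_mulr1 SU_mulV SU_mulrV.

Definition SU_diag : set SU := [set A : SU | is_diag_mx (SU_mx A)].

End Groups.

Record representation (G : groupType) (K : pzRingType) (V : lmodType K) := {
  act :> G -> V -> V;
  act_linear : forall g, linear (act g);
  act1 : forall v, act 1%g v = v;
  actM : forall g h v, act (g * h)%g v = act g (act h v) }.

Definition rep_iso (G : groupType) (K : pzRingType) (V W : lmodType K)
    (rho : representation G V) (sigma : representation G W) : Prop :=
  exists f : {linear V -> W},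
    bijective f /\ forall g v, f (rho g v) = sigma g (f v).

Definition irreducible (G : groupType) (K : fieldType) (V : vectType K)
    (rho : representation G V) : Prop :=
  (fullv != 0 :> {vspace V})%VS /\
  forall U : {vspace V}, (forall g v, v \in U -> rho g v \in U) ->
    U = 0%VS \/ U = fullv.

Definition fixed_by (G : groupType) (K : pzRingType) (V : lmodType K)
    (rho : representation G V) (H : set G) (v : V) : Prop :=
  forall h, H h -> rho h v = v.

(* All orbit maps g |-> g v are continuous, V being topologized by coordinates
   in a basis; for finite-dimensional V this is continuity of G -> GL(V). *)
Definition continuous_rep (R : realType) (n : nat) (V : vectType R[i])
    (rho : representation (SU R n) V) : Prop :=
  forall (v : V) (j : 'I_(\dim (fullv : {vspace V}))),
    continuous (fun g : SU R n => coord (vbasis fullv) j (rho g v) : R[i]).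

Definition trivial_rep (G : groupType) (K : pzRingType) :
    representation G K^o :=
  @Build_representation G K K^o (fun _ v => v)
    (fun _ _ _ _ => erefl) (fun _ => erefl) (fun _ _ _ => erefl).

Section Complexification.
Variables (R : realType) (V : lmodType R).

(* V (x)_R C, the pair (x, y) standing for x (x) 1 + y (x) i. *)
Definition complexification : Type := (V * V)%type.

HB.instance Definition _ := GRing.Zmodule.copy complexification (V * V)%type.

Definition cscale (z : R[i]) (u : complexification) : complexification :=
  (complex.Re z *: u.1 - complex.Im z *: u.2,
   complex.Re z *: u.2 + complex.Im z *: u.1).

Lemma cscaleA a b u : cscale a (cscale b u) = cscale (a * b) u.
Proof.
case: a b u => [a a'] [b b'] [x y]; rewrite /cscale /=; congr pair;
  rewrite !(scalerDr, scalerDl, scalerA, scalerN, scaleNr, opprD).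
  by rewrite -!addrA; congr (_ + _); rewrite addrA addrC.
by rewrite -!addrA; congr (_ + _); rewrite addrA addrC.
Qed.
Lemma cscale1 : left_id 1 cscale.
Proof. by move=> [x y]; rewrite /cscale /= !scale1r !scale0r subr0 addr0. Qed.
Lemma cscaleDr : right_distributive cscale +%R.
Proof.
move=> a [x y] [x' y']; congr pair => /=;
  by rewrite !scalerDr ?opprD addrACA.
Qed.
Lemma cscaleDl u : {morph cscale^~ u : a b / a + b}.
Proof.
move=> [a a'] [b b']; case: u => x y; congr pair => /=;
  by rewrite !scalerDl ?opprD addrACA.
Qed.

HB.instance Definition _ := GRing.Zmodule_isLmodule.Build R[i] complexification
  cscaleA cscale1 cscaleDr cscaleDl.

Variables (G : groupType) (rho : representation G V).

Definition cact (g : G) (u : complexification) : complexification :=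
  (rho g u.1, rho g u.2).

Lemma cact_linear g : linear (cact g).
Proof.
have L := act_linear rho g.
have D u w : rho g (u + w) = rho g u + rho g w.
  by have := L 1 u w; rewrite !scale1r.
have Z c w : rho g (c *: w) = c *: rho g w.
  have rho0 : rho g 0 = 0 by apply: (addIr (rho g 0)); rewrite -D !add0r.
  by have := L c w 0; rewrite rho0 !addr0.
move=> a [x y] [x' y']; congr pair => /=; first by rewrite -!scaleNr !(D, Z).
by rewrite !(D, Z).
Qed.
Lemma cact1 u : cact 1%g u = u.
Proof. by case: u => x y; rewrite /cact !act1. Qed.
Lemma cactM g h u : cact (g * h)%g u = cact g (cact h u).
Proof. by rewrite /cact !actM. Qed.

Definition complexify : representation G complexification :=
  Build_representation cact_linear cact1 cactM.

End Complexification.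

Section Isospectral.
Variables (R : realType) (n : nat).

Definition her0_pred : {pred 'M[R[i]]_n} :=
  fun T => (T \is hermsymmx) && (\tr T == 0).

(* An lmodType over R only: the scaling below is by real_complex. *)
Record Her0 := MkHer0 {
  Her0_mx :> 'M[R[i]]_n;
  Her0_mxP : Her0_mx \in her0_pred }.

HB.instance Definition _ := [isSub for Her0_mx].
HB.instance Definition _ := [Choice of Her0 by <:].

Lemma hermP (T : 'M[R[i]]_n) : reflect (T^t* = T) (T \is hermsymmx).
Proof.
rewrite is_hermitianmxE expr0 scale1r eq_sym; exact: eqP.
Qed.

Lemma her0_zmod_closed : zmod_closed her0_pred.
Proof.
split=> [|A B]; rewrite !unfold_in.
  by rewrite mxtrace0 eqxx andbT; apply/hermP; rewrite trmx0 map_mx0.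
move=> /andP[/hermP hA /eqP tA] /andP[/hermP hB /eqP tB].
apply/andP; split; last by rewrite raddfB /= tA tB subrr.
by apply/hermP; rewrite linearB /= map_mxB hA hB.
Qed.
HB.instance Definition _ :=
  GRing.SubChoice_isSubZmodule.Build 'M[R[i]]_n her0_pred Her0 her0_zmod_closed.

Lemma her0_scale_subproof (a : R) (T : Her0) :
  a%:C *: Her0_mx T \in her0_pred.
Proof.
case: T => T /= /andP[/hermP hT /eqP tT]; rewrite unfold_in.
rewrite linearZ /= tT mulr0 eqxx andbT; apply/hermP.
by rewrite linearZ /= map_mxZ hT; congr (_ *: _);
  exact: conjc_real.
Qed.
Definition her0_scale a T := MkHer0 (her0_scale_subproof a T).

Lemma her0_scaleA a b T : her0_scale a (her0_scale b T) = her0_scale (a * b) T.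
Proof. by apply/val_inj; rewrite /= scalerA rmorphM. Qed.
Lemma her0_scale1 : left_id 1 her0_scale.
Proof. by move=> T; apply/val_inj; rewrite /= rmorph1 scale1r. Qed.
Lemma her0_scaleDr : right_distributive her0_scale +%R.
Proof. by move=> a S T; apply/val_inj; rewrite /= scalerDr. Qed.
Lemma her0_scaleDl T : {morph her0_scale^~ T : a b / a + b}.
Proof. by move=> a b; apply/val_inj; rewrite /= rmorphD scalerDl. Qed.

HB.instance Definition _ := GRing.Zmodule_isLmodule.Build R Her0
  her0_scaleA her0_scale1 her0_scaleDr her0_scaleDl.

Lemma her0_act_subproof (A : SU R n) (T : Her0) :
  A *m T *m A^t* \in her0_pred.
Proof.
case: T => T /= /andP[/hermP hT /eqP tT]; rewrite unfold_in.
rewrite mxtrace_mulC mulmxA SU_adjK mul1mx tT eqxx andbT; apply/hermP.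
by rewrite !(trmx_mul, map_mxM) trmxCK hT mulmxA.
Qed.
Definition her0_act A T := MkHer0 (her0_act_subproof A T).

Lemma her0_act_linear A : linear (her0_act A).
Proof.
move=> a S T; apply/val_inj => /=.
by rewrite mulmxDr mulmxDl -scalemxAr -scalemxAl.
Qed.
Lemma her0_act1 T : her0_act 1%g T = T.
Proof. by apply/val_inj; rewrite /= mul1mx trmx1 map_mx1 mulmx1. Qed.
Lemma her0_actM A B T : her0_act (A * B)%g T = her0_act A (her0_act B T).
Proof. by apply/val_inj; rewrite /= trmx_mul map_mxM !mulmxA. Qed.

Definition isospectral : representation (SU R n) Her0 :=
  Build_representation her0_act_linear her0_act1 her0_actM.

End Isospectral.

(* Main.v *)
From HB Require Import structures.
Require Import Defs.
From mathcomp Require Import all_boot all_order all_algebra.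
From mathcomp Require Import perm.
From mathcomp Require Import all_classical all_reals all_analysis.
From mathcomp Require Import complex.
From mathcomp Require Import ring lra zify.
Set Implicit Arguments.
Unset Strict Implicit.
Unset Printing Implicit Defensive.
Import Order.TTheory GRing.Theory Num.Theory.
Import numFieldNormedType.Exports.
Local Open Scope classical_set_scope.
Local Open Scope ring_scope.
Local Open Scope complex_scope.
Local Open Scope sesquilinear_scope.

(** Let V be a nontrivial irreducible representation of SU_n with a nonzero
    vector v fixed by the diagonal matrices and dim V <= n^2 - 1.

    The first task is to replace the continuous group action by an action of
    the Lie algebra. A continuous homomorphism r from SU_n to matrices is
    Lipschitz at 1 (lipschitz_at1), because the powers of r(g) control
    r(g) - 1. Hence 2^k (r(exp(2^-k X)) - 1) converges for every X in su_n, and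
    the limit D(X) depends only on the velocity X of the curve
    (exists_differential). This makes D additive, equivariant under
    conjugation and, by expanding once more, compatible with brackets
    (differential_bracket); its complex-linear extension is an action of
    sl_n(C) (lie_of_rep). Conversely r(exp X) is the limit of
    (1 + 2^-k D(X))^(2^k) (rep_approx) and exp maps su_n onto SU_n
    (exp_seq_onto), so a subspace stable under the Lie algebra is stable under
    the group, a vector killed by the Lie algebra is fixed, and a Lie
    intertwiner is a group intertwiner.

    The second task is algebraic. The vector v has weight 0, and weights are
    moved by the roots e_i - e_j, the weights of the matrix units E_ij. If all
    E_ij kill v then v is fixed by SU_n and V is trivial. Otherwise some root is
    a weight, and so is every root, because the set of weights is stable under
    coordinate permutations, which are induced by signed permutation matrices
    in SU_n. Any weight other than 0 and the roots would have at least n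
    images under permutations, and V would have more than n^2 - 1 distinct
    weights (weight_dichotomy). So V has a vector w of weight e_0 - e_(n-1)
    killed by the raising operators. In the direct sum of V and sl_n the pair
    (w, E_0max) generates a submodule in which its weight occurs only once;
    since V and sl_n are simple, this submodule is the graph of an isomorphism
    (iso_traceless_of_highest). Finally a traceless complex matrix is
    H + iH' with H and H' Hermitian and traceless, which identifies sl_n under
    conjugation with the complexified isospectral model. *)

(** * Lie actions of the matrix algebra *)

(** The span of an arbitrary family, with its induction principle: a finite
    subfamily whose span has maximal dimension already spans everything. *)
Lemma exists_span (K : fieldType) (V : vectType K) (P : V -> Prop) :
  exists U : {vspace V}, (forall x, P x -> x \in U) /\
    forall Q : V -> Prop, Q 0 -> (forall a x y, Q x -> Q y -> Q (a *: x + y)) ->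
      (forall x, P x -> Q x) -> forall x, x \in U -> Q x.
Proof.
pose R d := `[< exists s : seq V, (forall x, x \in s -> P x) /\ \dim (span s) = d >].
have exR : exists d, R d.
  by exists 0%N; apply/asboolP; exists [::]; rewrite span_nil dimv0.
have leR d : R d -> (d <= \dim (fullv : {vspace V}))%N.
  by move=> /asboolP[s [_ <-]]; apply/dimvS/subvf.
case: (ex_maxnP exR leR) => d /asboolP[s [sP sd]] dmax.
exists (span s); split=> [x Px|Q Q0 QD PQ x].
  have sub : (span s <= span (x :: s))%VS.
    by apply: sub_span => y ys; rewrite inE ys orbT.
  have le : (\dim (span (x :: s)) <= d)%N.
    apply: dmax; apply/asboolP; exists (x :: s); split=> // y.
    by rewrite inE => /predU1P[->//|/sP].
  have /eqP-> : span s == span (x :: s) by rewrite eqEdim sub sd.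
  by apply: memv_span; rewrite inE eqxx.
have aux (r : seq V) : {subset r <= s} -> forall c : nat -> K,
    Q (\sum_(i < size r) c i *: r`_i).
  elim: r => [|y r IH] rs c; first by rewrite big_ord0.
  rewrite big_ord_recl; apply: QD => /=.
    by apply/PQ/sP/rs; rewrite inE eqxx.
  by apply: (IH _ (fun i => c i.+1)) => z zr; apply: rs; rewrite inE zr orbT.
move=> xs; rewrite (@coord_span _ _ _ (in_tuple s) _ xs).
pose c k := oapp (fun j => coord (in_tuple s) j x) 0 (insub k : option 'I_(size s)).
rewrite (eq_bigr (fun i : 'I_(size s) => c i *: s`_i)); first exact: aux.
by move=> i _; rewrite /c valK.
Qed.

(** A linear action of gl_n by brackets. Working with all n x n matrices rather
    than traceless ones makes the matrix units E_ij available; the actions of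
    interest kill the scalar matrices. *)
Record lie_action (K : fieldType) (n : nat) (V : lmodType K) := LieAction {
  la :> 'M[K]_n -> V -> V;
  laDl : forall a A B x, la (a *: A + B) x = a *: la A x + la B x;
  laDr : forall A a x y, la A (a *: x + y) = a *: la A x + la A y;
  laB : forall A B x, la (A *m B - B *m A) x = la A (la B x) - la B (la A x) }.

Section LieActTheory.
Variables (K : fieldType) (n : nat) (V : lmodType K) (e : lie_action n V).
Implicit Types (A B : 'M[K]_n) (x y : V).

Lemma la0r A : e A 0 = 0.
Proof.
have := laDr e A 1 0 0; rewrite !scale1r addr0 => /eqP.
by rewrite -subr_eq0 opprD addrA subrr add0r oppr_eq0 => /eqP.
Qed.

Lemma la0l x : e 0 x = 0.
Proof.
have := laDl e 1 0 0 x; rewrite !scale1r addr0 => /eqP.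
by rewrite -subr_eq0 opprD addrA subrr add0r oppr_eq0 => /eqP.
Qed.

Lemma laZr A a x : e A (a *: x) = a *: e A x.
Proof. by have := laDr e A a x 0; rewrite la0r !addr0. Qed.

Lemma laZl A a x : e (a *: A) x = a *: e A x.
Proof. by have := laDl e a A 0 x; rewrite la0l !addr0. Qed.

Lemma laDvr A x y : e A (x + y) = e A x + e A y.
Proof. by have := laDr e A 1 x y; rewrite !scale1r. Qed.

Lemma laDvl A B x : e (A + B) x = e A x + e B x.
Proof. by have := laDl e 1 A B x; rewrite !scale1r. Qed.

Lemma laSr A (I : Type) (s : seq I) (f : I -> V) :
  e A (\sum_(i <- s) f i) = \sum_(i <- s) e A (f i).
Proof. exact: (big_morph _ (laDvr A) (la0r A)). Qed.

Lemma laSl x (I : Type) (s : seq I) (f : I -> 'M[K]_n) :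
  e (\sum_(i <- s) f i) x = \sum_(i <- s) e (f i) x.
Proof. exact: (big_morph (e^~ x) (fun A B => laDvl A B x) (la0l x)). Qed.

Lemma la_entries A x : e A x = \sum_i \sum_j A i j *: e (delta_mx i j) x.
Proof.
rewrite {1}(matrix_sum_delta A) laSl; apply: eq_bigr => i _.
by rewrite laSl; apply: eq_bigr => j _; rewrite laZl.
Qed.

End LieActTheory.

Section LieActConstructions.
Variables (K : fieldType) (n : nat).

Definition ad_fun (A x : 'M[K]_n) := A *m x - x *m A.

Definition ad_action : lie_action n 'M[K]_n.
Proof.
apply: (@LieAction _ _ _ ad_fun) => [a A B x|A a x y|A B x]; rewrite /ad_fun.
- rewrite mulmxDl mulmxDr -scalemxAl -scalemxAr scalerBr opprD !addrA.
  by congr (_ - _); rewrite addrAC.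
- rewrite mulmxDl mulmxDr -scalemxAl -scalemxAr scalerBr opprD !addrA.
  by congr (_ - _); rewrite addrAC.
- rewrite !mulmxBl !mulmxBr !mulmxA.
  move: (A *m B *m x) (B *m A *m x) (x *m A *m B) (x *m B *m A) (A *m x *m B) (B *m x *m A).
  by move=> a b c d f g; apply/matrixP => i j; rewrite !mxE; ring.
Defined.

Definition prod_action (V W : lmodType K) (e : lie_action n V) (f : lie_action n W) :
  lie_action n (V * W)%type.
Proof.
apply: (@LieAction _ _ _ (fun A x => (e A x.1, f A x.2))) => [a A B x|A a x y|A B x].
- by congr pair; rewrite laDl.
- by congr pair; rewrite laDr.
- by congr pair; rewrite laB.
Defined.

End LieActConstructions.

(** * Weights *)

Lemma comm_delta_diag (K : fieldType) n (k i j : 'I_n) :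
  delta_mx k k *m delta_mx i j - delta_mx i j *m delta_mx k k
  = ((k == i)%:R - (k == j)%:R) *: delta_mx i j :> 'M[K]_n.
Proof.
rewrite !mul_delta_mx_cond scalerBl [j == k]eq_sym.
by case: eqP => [->|_]; case: eqP => [->|_];
  rewrite ?mulr1n ?mulr0n ?scale1r ?scale0r.
Qed.

Section Weights.
Variables (K : numFieldType) (n : nat).
Local Notation wt := {ffun 'I_n -> int}.
Implicit Types (lam mu : wt) (i j k : 'I_n).

(** Only integral weights are considered; those reached from the weight 0 are of
    this kind. *)
Definition weight (V : lmodType K) (e : lie_action n V) lam (x : V) :=
  forall k, e (delta_mx k k) x = (lam k)%:~R *: x.

Definition root_wt i j : wt := [ffun k => (k == i)%:R - (k == j)%:R].

Section Theory.
Variables (V : lmodType K) (e : lie_action n V).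

Lemma weight0 lam : weight e lam 0.
Proof. by move=> k; rewrite la0r scaler0. Qed.

Lemma weightD lam x y : weight e lam x -> weight e lam y -> weight e lam (x + y).
Proof. by move=> wx wy k; rewrite laDvr wx wy scalerDr. Qed.

Lemma weightZ lam a x : weight e lam x -> weight e lam (a *: x).
Proof. by move=> wx k; rewrite laZr wx !scalerA mulrC. Qed.

(** By [E_kk, E_ij] = ((k == i) - (k == j)) E_ij. *)
Lemma weight_E lam x i j :
  weight e lam x -> weight e (lam + root_wt i j) (e (delta_mx i j) x).
Proof.
move=> wx k; have := laB e (delta_mx k k) (delta_mx i j) x.
rewrite comm_delta_diag laZl wx laZr => /eqP; rewrite eq_sym subr_eq => /eqP->.
by rewrite !ffunE rmorphD rmorphB !rmorph_nat [RHS]scalerDl addrC.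
Qed.

(** Vectors of distinct weights are independent, in the form used below: pick
    one term of the sum, apply E_kk - mu_k for a coordinate k where its weight mu
    differs from lam; this kills that term, keeps the others in their weight
    spaces and multiplies x by a nonzero scalar, so induction applies. *)
Lemma weight_sep (I : eqType) (s : seq I) (f : I -> V) (lam : wt) (x : V) :
  weight e lam x ->
  (forall a : I, a \in s -> exists2 mu, mu != lam & weight e mu (f a)) ->
  x = \sum_(a <- s) f a -> x = 0.
Proof.
elim: s f x => [|y s IH] f x wx; first by rewrite big_nil.
move=> hs; have [|mu ne wy] := hs y; first by rewrite inE eqxx.
have [k nk] : exists k, mu k != lam k.
  apply/existsP; apply: contraNT ne => /existsPn h; apply/eqP/ffunP => k.
  by apply/eqP; rewrite -[_ == _]negbK h.
rewrite big_cons => def_x.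
have h : ((lam k)%:~R - (mu k)%:~R) *: x = 0.
  pose g z := e (delta_mx k k) (f z) - (mu k)%:~R *: f z.
  apply: (IH g); first exact: weightZ.
    move=> z zs; have [|nu nenu wz] := hs z; first by rewrite inE zs orbT.
    by exists nu => //; rewrite /g wz -scalerBl; apply: weightZ.
  rewrite scalerBl -wx def_x laDvr wy scalerDr opprD addrACA subrr add0r laSr.
  by rewrite scaler_sumr -sumrB.
by move/eqP: h; rewrite scaler_eq0 subr_eq0 eqr_int eq_sym (negPf nk) => /eqP.
Qed.

End Theory.

Lemma weight_card (V : vectType K) (e : lie_action n V) (I : finType) (lam : I -> wt)
    (x : I -> V) : injective lam -> (forall a, weight e (lam a) (x a)) ->
  (forall a, x a != 0) -> (#|I| <= \dim (fullv : {vspace V}))%N.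
Proof.
move=> lami wx x0; pose X := [tuple x (enum_val i) | i < #|I|].
have /eqP dX : free X.
  apply/freeP => c Xc0 i; apply: contraTeq (x0 (enum_val i)) => ci.
  rewrite negbK.
  have h : - (c i *: x (enum_val i)) = 0.
    apply: (@weight_sep _ e _ [seq a <- enum 'I_#|I| | a != i]
      (fun a => c a *: X`_a) (lam (enum_val i))).
    - by rewrite -scaleNr; apply/weightZ/wx.
    - move=> j; rewrite mem_filter => /andP[ji _].
      rewrite -tnth_nth tnth_mktuple; exists (lam (enum_val j)).
        by apply: contraNneq ji => /lami/enum_val_inj->.
      exact/weightZ/wx.
    rewrite big_filter big_enum_cond /=.
    apply/eqP; rewrite eq_sym -subr_eq0 opprK addrC; apply/eqP.
    have -> : x (enum_val i) = X`_i by rewrite -tnth_nth tnth_mktuple.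
    by rewrite -[RHS]Xc0 [RHS](bigD1 i).
  by move/eqP: h; rewrite oppr_eq0 scaler_eq0 (negPf ci).
by rewrite size_tuple in dX; rewrite -dX dimvS // subvf.
Qed.

(** Pairing with (0, -1, ..., -(n-1)): the root e_i - e_j has height j - i, so
    raising operators E_ij, i < j, are those that increase the height, and
    e_0 - e_(n-1) is the unique root of maximal height. *)
Definition height lam : int := - \sum_k lam k * (k : nat)%:Z.

Lemma heightD lam mu : height (lam + mu) = height lam + height mu.
Proof.
rewrite /height -opprD -big_split; congr (- _); apply: eq_bigr => k _.
by rewrite ffunE mulrDl.
Qed.

Lemma height_root i j : height (root_wt i j) = (j : nat)%:Z - (i : nat)%:Z.
Proof.
rewrite /height -opprB; congr (- _).
under eq_bigr do rewrite ffunE mulrBl.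
rewrite sumrB; congr (_ - _).
  by rewrite (bigD1 i) //= eqxx mul1r big1 ?addr0 // => k /negPf->; rewrite mul0r.
by rewrite (bigD1 j) //= eqxx mul1r big1 ?addr0 // => k /negPf->; rewrite mul0r.
Qed.

End Weights.

(** * Ideals of the traceless matrices *)

Lemma delta_mul_delta (K : fieldType) n (X : 'M[K]_n) (i j k l : 'I_n) :
  delta_mx i j *m X *m delta_mx k l = X j k *: delta_mx i l.
Proof.
rewrite (matrix_sum_delta X) mulmx_sumr mulmx_suml !summxE.
rewrite (bigD1 j) //= [X in _ + X]big1 => [|a ja]; last first.
  rewrite -mulmxA mulmx_suml mulmx_sumr big1 // => b _.
  by rewrite -scalemxAl -scalemxAr mulmxA mul_delta_mx_0 ?mul0mx ?scaler0 // eq_sym.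
rewrite addr0 mulmx_sumr mulmx_suml (bigD1 k) //= big1 => [|b bk]; last first.
  by rewrite -scalemxAr -scalemxAl mul_delta_mx mul_delta_mx_0 ?scaler0.
rewrite addr0 -scalemxAr -scalemxAl !mul_delta_mx; congr (_ *: _).
rewrite (bigD1 j) //= summxE (bigD1 k) //= !mxE !eqxx mulr1.
rewrite big1 => [|b /negPf bk]; last by rewrite !mxE eq_sym bk andbF mulr0.
rewrite big1 => [|a /negPf aj]; first by rewrite !addr0.
by rewrite summxE big1 // => b _; rewrite !mxE eq_sym aj mulr0.
Qed.

Section AdStable.
Variables (K : numFieldType) (n : nat).
Implicit Types (A X : 'M[K]_n).
Local Notation E := (delta_mx : 'I_n -> 'I_n -> 'M[K]_n).

Variable U : 'M[K]_n -> Prop.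
Hypothesis U0 : U 0.
Hypothesis UD : forall a X Y, U X -> U Y -> U (a *: X + Y).
Hypothesis Uad : forall A X, U X -> U (A *m X - X *m A).

Let UZ a X : U X -> U (a *: X).
Proof. by move=> UX; rewrite -[_ *: _]addr0; apply: UD. Qed.

Let UZK (a : K) X : a != 0 -> U (a *: X) -> U X.
Proof. by move=> a0 /(UZ a^-1); rewrite scalerA mulVf // scale1r. Qed.

Let Usum (I : Type) (s : seq I) (P : pred I) (F : I -> 'M[K]_n) :
  (forall i, P i -> U (F i)) -> U (\sum_(i <- s | P i) F i).
Proof.
by move=> UF; elim/big_ind: _ => // X Y UX UY; rewrite -[X]scale1r; apply: UD.
Qed.

(** Bracketing with a matrix unit moves the row or the column index of E_ij, and
    [E_ji, [E_ji, E_ij]] = -2 E_ji exchanges them. *)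
Lemma ad_stable_delta (i j k l : 'I_n) : i != j -> k != l -> U (E i j) -> U (E k l).
Proof.
have row a b c : a != b -> c != b -> U (E a b) -> U (E c b).
  move=> ab cb UE; have := Uad (E c a) UE.
  by rewrite mul_delta_mx mul_delta_mx_0 ?subr0 // eq_sym.
have col a b c : a != b -> a != c -> U (E a b) -> U (E a c).
  move=> ab ac UE; have := Uad (E b c) UE.
  rewrite mul_delta_mx [X in X - _]mul_delta_mx_0; last by rewrite eq_sym.
  by rewrite sub0r -scaleN1r; apply: UZK; rewrite oppr_eq0 oner_neq0.
move=> ij kl UE; have [kj|kj] := eqVneq k j; last first.
  by apply: (col _ _ _ kj kl); apply: row UE.
rewrite {k}kj in kl *; have [->|li] := eqVneq l i.
  have := Uad (E j i) (Uad (E j i) UE).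
  rewrite !mul_delta_mx mulmxBl mulmxBr !mul_delta_mx.
  rewrite [X in U (X - _ - _)]mul_delta_mx_0 //.
  rewrite [X in U (_ - (_ - X))]mul_delta_mx_0 //.
  move=> h; apply: (@UZK (-2)); first by rewrite oppr_eq0 pnatr_eq0.
  by rewrite scaleNr scaler_nat mulr2n opprD; move: h; rewrite sub0r subr0.
by apply: (row i l) => //; [rewrite eq_sym|rewrite eq_sym in li; apply: (col i j)].
Qed.

Lemma ad_stable_traceless i j A : i != j -> U (E i j) -> \tr A = 0 -> U A.
Proof.
move=> ij UE trA; have UEkl k l : k != l -> U (E k l).
  by move=> kl; apply: ad_stable_delta UE.
have UH k l : U (E k k - E l l).
  have [->|kl] := eqVneq k l; first by rewrite subrr.
  have lk : l != k by rewrite eq_sym.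
  by have := Uad (E k l) (UEkl l k lk); rewrite !mul_delta_mx.
have -> : A = \sum_k \sum_(l | l != k) A k l *: E k l
              + \sum_k A k k *: (E k k - E i i).
  under [X in _ + X]eq_bigr do rewrite scalerBr.
  rewrite sumrB -scaler_suml -/(mxtrace A) trA scale0r subr0 -big_split /=.
  rewrite {1}(matrix_sum_delta A); apply: eq_bigr => k _.
  by rewrite (bigD1 k) //= addrC.
rewrite -[X in U (X + _)]scale1r; apply: UD.
  apply: Usum => k _; apply: Usum => l lk; apply/UZ/UEkl.
  by rewrite eq_sym.
by apply: Usum => k _; apply/UZ/UH.
Qed.

(** A nonzero ideal of sl_n contains a matrix unit: if X_kl is nonzero with
    k != l then [E_lk, [E_lk, X]] = -2 X_kl E_lk, and if X is diagonal then
    [E_kl, X] = (X_ll - X_kk) E_kl. With ad_stable_traceless this is the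
    simplicity of sl_n. *)
Lemma ad_stable_delta_of_nonscalar X i j : i != j ->
  \tr X = 0 -> X != 0 -> U X -> U (E i j).
Proof.
move=> ij trX X0 UX.
have [[k [l [kl Xkl]]]|] := pselect (exists k l, k != l /\ X k l != 0).
  apply: (@ad_stable_delta l k) => //; first by rewrite eq_sym.
  have h := Uad (E l k) (Uad (E l k) UX).
  apply: (@UZK (-2 * X k l)).
    by rewrite mulf_neq0 // oppr_eq0 pnatr_eq0.
  rewrite !mulmxBl !mulmxBr !mulmxA mul_delta_mx_0 // !mul0mx in h.
  rewrite -[X *m _ *m _]mulmxA mul_delta_mx_0 // mulmx0 sub0r subr0 in h.
  rewrite delta_mul_delta in h.
  by rewrite mulNr scaleNr -scalerA scaler_nat mulr2n opprD.
move=> offdiag.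
have Xoff k l : k != l -> X k l = 0.
  by move=> kl; apply/eqP/negP => /negP Xkl; apply: offdiag; exists k, l.
have [[k [l Xkl]]|diag] := pselect (exists k l, X k k != X l l).
  have kl : k != l by apply: contraNneq Xkl => ->.
  apply: (@ad_stable_delta k l) => //; apply: (@UZK (X l l - X k k)).
    by rewrite subr_eq0 eq_sym.
  have EX : E k l *m X = X l l *: E k l.
    apply/matrixP => a b; rewrite !mxE (bigD1 l) //= big1 => [|c /negPf cl].
      rewrite !mxE eqxx andbT addr0 mulrC; have [->|bl] := eqVneq b l.
        by rewrite andbT.
      by rewrite Xoff ?mul0r ?andbF ?mulr0 // eq_sym.
    by rewrite !mxE cl andbF mul0r.
  have XE : X *m E k l = X k k *: E k l.
    apply/matrixP => a b; rewrite !mxE (bigD1 k) //= big1 => [|c /negPf ck].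
      rewrite !mxE eqxx addr0; have [->//|ak] := eqVneq a k.
      by rewrite Xoff //= mulr0 mul0r.
    by rewrite !mxE ck mulr0.
  by have := Uad (E k l) UX; rewrite EX XE -scalerBl.
case/eqP: X0; have Xd k : X k k = 0.
  have : \tr X = (X k k) *+ n.
    rewrite /mxtrace (eq_bigr (fun=> X k k)) ?sumr_const ?card_ord // => l _.
    by apply/eqP/negP => /negP h; apply: diag; exists l, k.
  rewrite trX => /esym/eqP; rewrite mulrn_eq0 => /orP[/eqP n0|/eqP//].
  by exfalso; move: (ltn_ord k); rewrite [X in (_ < X)%N]n0.
apply/matrixP => k l; rewrite mxE.
by have [->|/Xoff//] := eqVneq k l.
Qed.

End AdStable.

(** * Small irreducible actions with a zero weight *)

Lemma vspace_of_linear_pred (K : fieldType) (V : vectType K) (P : V -> Prop) :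
  P 0 -> (forall a x y, P x -> P y -> P (a *: x + y)) ->
  exists U : {vspace V}, forall x, (x \in U) <-> P x.
Proof.
move=> P0 PD; have [U [PU UP]] := exists_span P.
by exists U => x; split; [apply: UP|apply: PU].
Qed.

Section Classification.
Variables (K : numFieldType) (m : nat).
Local Notation n := m.+2.
Local Notation wt := {ffun 'I_n -> int}.
Local Notation E := (delta_mx : 'I_n -> 'I_n -> 'M[K]_n).
Variables (V : vectType K) (e : lie_action n V).
Hypothesis e1 : forall x, e 1%:M x = 0.
Hypothesis irr : forall U : {vspace V},
  (forall A x, x \in U -> e A x \in U) -> U = 0%VS \/ U = fullv.
Hypothesis dimV : (\dim (fullv : {vspace V}) <= n ^ 2 - 1)%N.
(* The operators S stand for the group elements that transpose two coordinates. *)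
Hypothesis swap : forall i j : 'I_n, exists S : V -> V,
  [/\ forall x, S x = 0 -> x = 0, forall c x, S (c *: x) = c *: S x
    & forall k x, e (E (tperm i j k) (tperm i j k)) (S x) = S (e (E k k) x)].

Definition is_weight (lam : wt) := exists2 x, x != 0 & weight e lam x.

(** The identity matrix acts by zero. *)
Lemma is_weight_sum lam : is_weight lam -> \sum_k lam k = 0.
Proof.
move=> [x x0 wx]; have := e1 x.
have -> : 1%:M = \sum_k E k k.
  apply/matrixP => i j; rewrite mxE summxE (bigD1 i) //= mxE eqxx.
  rewrite big1 ?addr0 1?eq_sym // => k /negPf ki.
  by rewrite mxE eq_sym ki.
rewrite laSl (eq_bigr (fun k => (lam k)%:~R *: x)) => [|k _]; last exact: wx.
rewrite -scaler_suml => /eqP; rewrite scaler_eq0 (negPf x0) orbF.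
by rewrite -rmorph_sum intr_eq0 => /eqP.
Qed.

Definition swap_wt (i j : 'I_n) (lam : wt) : wt := [ffun k => lam (tperm i j k)].

Lemma is_weight_swap i j lam : is_weight lam -> is_weight (swap_wt i j lam).
Proof.
have [S [S0 SZ SE]] := swap i j; move=> [x x0 wx]; exists (S x).
  by apply: contraNneq x0 => /S0->.
by move=> k; rewrite -{1 2}(tpermK i j k) SE wx SZ ffunE.
Qed.

Lemma swap_root i j k l : swap_wt i j (root_wt k l) = root_wt (tperm i j k) (tperm i j l).
Proof.
by apply/ffunP => a; rewrite !ffunE -!(can2_eq (tpermK i j) (tpermK i j)).
Qed.

Lemma swap_wtK i j : involutive (swap_wt i j).
Proof. by move=> lam; apply/ffunP => k; rewrite !ffunE tpermK. Qed.

Lemma is_weight_root i j k l :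
  i != j -> k != l -> is_weight (root_wt i j) -> is_weight (root_wt k l).
Proof.
move=> ij kl /(is_weight_swap i k); rewrite swap_root tpermL.
set j' := tperm i k j => /(is_weight_swap j' l); rewrite swap_root tpermL tpermD //.
- by rewrite /j' -(inj_eq (@perm_inj _ (tperm i k))) tpermK tpermR eq_sym.
- by rewrite eq_sym.
Qed.

Definition is_root (lam : wt) := exists i j, i != j /\ lam = root_wt i j.

Lemma root_inj (i j k l : 'I_n) : i != j -> root_wt i j = root_wt k l -> i = k /\ j = l.
Proof.
move=> ij /ffunP h; split; apply/eqP.
  by have := h i; rewrite !ffunE eqxx (negPf ij); case: eqP; case: eqP.
by have := h j; rewrite !ffunE eqxx eq_sym (negPf ij); case: (j =P l); case: (j =P k).
Qed.

Lemma root_neq0 i j : i != j -> root_wt i j != 0 :> wt.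
Proof.
by move=> ij; apply/eqP => /ffunP/(_ i); rewrite !ffunE eqxx (negPf ij).
Qed.

Lemma is_root_swap i j lam : is_root (swap_wt i j lam) -> is_root lam.
Proof.
move=> [k [l [kl h]]]; exists (tperm i j k), (tperm i j l); split.
  by rewrite (inj_eq perm_inj).
by rewrite -swap_root -h swap_wtK.
Qed.

(** The counting argument. A weight mu that is neither zero nor a root takes two
    different values, so that transposing coordinates produces n - 1 further
    weights tau_k; with 0 and the n (n - 1) roots this makes n^2 distinct
    weights, too many for the dimension. *)
Lemma weight_dichotomy (i0 j0 : 'I_n) mu : i0 != j0 -> is_weight (root_wt i0 j0) ->
  is_weight 0 -> is_weight mu -> mu = 0 \/ is_root mu.
Proof.
move=> ij0 w_root w_0 w_mu; apply: contrapT => /not_orP[/eqP mu0 mu_root].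
have [a [b mu_ab]] : exists a b, mu a != mu b.
  apply: contrapT => h; case/eqP: mu0; apply/ffunP => k; rewrite ffunE.
  have : \sum_(k < n) mu k = mu k *+ n.
    rewrite (eq_bigr (fun=> mu k)) ?sumr_const ?card_ord // => l _.
    by apply/eqP/negP => /negP hl; apply: h; exists l, k.
  by rewrite is_weight_sum // => /esym/eqP; rewrite mulrn_eq0 => /eqP.
(* tau_k moves the value mu_a to place k if it is not there already, and
   otherwise replaces the value at k by mu_b; the positions of the value mu_a
   tell the tau_k, k != a, apart. *)
pose tau k := if mu k == mu a then swap_wt b k mu else swap_wt a k mu.
(* The diagonal of the index set carries the tau_k, and 0 at (a, a). *)
pose f (p : 'I_n * 'I_n) : wt :=
  if p.1 != p.2 then root_wt p.1 p.2 else if p.1 == a then 0 else tau p.1.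
have tau0 k : tau k != 0.
  apply: contraNneq mu0 => h; rewrite -[mu](swap_wtK b k) -1?[X in _ || X](swap_wtK a k).
  move: h; rewrite /tau; case: ifP => _ h.
    by rewrite h; apply/eqP/ffunP => l; rewrite !ffunE.
  by rewrite swap_wtK -[mu](swap_wtK a k) h; apply/eqP/ffunP => l; rewrite !ffunE.
have tau_root k : ~ is_root (tau k).
  by rewrite /tau; case: ifP => _ /is_root_swap.
have tau_inj k l : k != a -> l != a -> tau k = tau l -> k = l.
  move=> ka la; rewrite /tau; case: ifP => mk; case: ifP => ml /ffunP h.
  - apply/eqP/negP => /negP kl; have := h k; rewrite !ffunE tpermR tpermD //.
    + by move=> hb; rewrite hb eq_sym mk in mu_ab.
    + by apply: contraNneq mu_ab => ->; rewrite eq_sym mk.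
    + by rewrite eq_sym.
  - have := h a; rewrite !ffunE tpermL tpermD //.
    + by move=> hl; rewrite hl eqxx in ml.
    + by apply: contraNneq mu_ab => ->.
  - have := h a; rewrite !ffunE tpermL tpermD //.
    + by move=> hl; rewrite hl eqxx in mk.
    + by apply: contraNneq mu_ab => ->.
  - apply/eqP/negP => /negP kl; have := h k; rewrite !ffunE tpermR tpermD //.
    + by move=> hb; rewrite hb eqxx in mk.
    + by rewrite eq_sym.
    + by rewrite eq_sym.
have f_inj : injective f.
  move=> [i j] [k l]; rewrite /f /=.
  have [->|ij] := eqVneq i j; have [->|kl] := eqVneq k l => /=.
  - have [->|ja] := eqVneq j a; have [->|la] := eqVneq l a => //= h.
    + by have := tau0 l; rewrite -h eqxx.
    + by have := tau0 j; rewrite h eqxx.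
    + by rewrite (tau_inj _ _ ja la h).
  - have [_|_] := eqVneq j a => h; first by have := root_neq0 kl; rewrite -h eqxx.
    by case: (tau_root j); exists k, l.
  - have [_|_] := eqVneq l a => h; first by have := root_neq0 ij; rewrite h eqxx.
    by case: (tau_root l); exists i, j.
  - by move/(root_inj ij) => [-> ->].
have f_wt p : exists x, x != 0 /\ weight e (f p) x.
  suff [x x0 wx] : is_weight (f p) by exists x.
  rewrite /f; case: ifP => [ij|_]; first exact: is_weight_root w_root.
  case: ifP => // _; rewrite /tau.
  by case: ifP => _; apply: is_weight_swap.
have [x hx] := choice f_wt.
have := weight_card f_inj (fun p => (hx p).2) (fun p => (hx p).1).
rewrite card_prod card_ord => le; have := leq_trans le dimV.
by rewrite -mulnn; lia.
Qed.

Local Notation o0 := (ord0 : 'I_n).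
Local Notation om := (ord_max : 'I_n).
Local Notation th := (root_wt o0 om).
Local Notation P := (prod_action e (@ad_action K n)).

Lemma weight_prod lam x A :
  weight e lam x -> weight (@ad_action K n) lam A -> weight P lam (x, A).
Proof. by move=> wx wA k; apply: (congr2 pair (wx k) (wA k)). Qed.

Lemma weight_ad i j : weight (@ad_action K n) (root_wt i j) (E i j).
Proof.
move=> k; rewrite /= /ad_fun comm_delta_diag ffunE.
by rewrite rmorphB /= !rmorph_nat.
Qed.

Section HighestWeight.
Variable w : V.
Hypothesis w0 : w != 0.
Hypothesis w_th : weight e th w.
Hypothesis w_raise : forall i j : 'I_n, (i < j)%N -> e (E i j) w = 0.

Let x0 : (V * 'M[K]_n)%type := (w, E o0 om).

(** Vectors obtained from the highest weight pair (w, E_0max) of the direct sum of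
    V and gl_n by applying lowering operators. *)
Inductive lower_word : (V * 'M[K]_n)%type -> Prop :=
| LowerNil : lower_word x0
| LowerCons (i j : 'I_n) y : (j < i)%N -> lower_word y -> lower_word (P (E i j) y).

Let weight_x0 : weight P th x0.
Proof. exact: weight_prod (weight_ad _ _). Qed.

Let raise_x0 (i j : 'I_n) : (i < j)%N -> P (E i j) x0 = 0.
Proof.
move=> ij; rewrite /= w_raise // /ad_fun !mul_delta_mx_0 ?subrr //.
  by rewrite -val_eqE /= neq_ltn (leq_trans ij) ?orbT // -ltnS.
by rewrite -val_eqE /= neq_ltn (leq_trans _ ij) ?orbT.
Qed.

Lemma lower_word_weight y : lower_word y ->
  exists mu, weight P mu y /\ (y = x0 \/ (height mu < height th)).
Proof.
have main : lower_word y -> exists mu, weight P mu y /\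
    ((y = x0 /\ mu = th) \/ (height mu < height th)).
  elim=> [|i j {}y ji _ [mu [wy h]]]; first by exists th; split=> //; left.
  exists (mu + root_wt i j); split; first exact: weight_E.
  right; rewrite heightD height_root.
  by case: h => [[_ ->]|h]; lia.
by move=> /main[mu [wy h]]; exists mu; split=> //; case: h => [[]|]; [left|right].
Qed.

(** The span M of the lowering words is stable under every E_ij, by induction on
    the word: E_ij F y = F E_ij y + [E_ij, F] y, and [E_ij, F] is again a
    combination of matrix units. All words but the empty one have smaller height,
    so the top weight occurs in M only along (w, E_0max). *)
Lemma exists_graph : exists M : {vspace V * 'M[K]_n},
  [/\ x0 \in M, forall A y, y \in M -> P A y \in M,
      forall y, y \in M -> \tr y.2 = 0
    & forall y, y \in M -> weight P th y -> exists c, y = c *: x0].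
Proof.
have [M [wordM indM]] := exists_span lower_word; exists M.
have lowM (i j : 'I_n) y : (j < i)%N -> y \in M -> P (E i j) y \in M.
  move=> ji; move: y; apply: indM => [|a x z Px Pz|x wx].
  - by rewrite la0r mem0v.
  - by rewrite laDr memvD // memvZ.
  - by apply/wordM/LowerCons.
have EM A y : (forall i j, P (E i j) y \in M) -> P A y \in M.
  move=> h; rewrite la_entries; apply: memv_suml => i _; apply: memv_suml => j _.
  exact: memvZ.
have wordE y : lower_word y -> forall A, P A y \in M.
  elim=> [|k l {}y lk wy IH] A; apply: EM => i j.
    have [ij|ji|/val_inj<-] := ltngtP i j.
    - by rewrite raise_x0 ?mem0v.
    - by apply/wordM/LowerCons/LowerNil.
    - by rewrite weight_x0 memvZ // wordM //; apply: LowerNil.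
  have := laB P (E i j) (E k l) y => /eqP; rewrite eq_sym subr_eq => /eqP->.
  by apply: memvD; [apply: IH|apply: lowM => //; apply: IH].
split.
- exact/wordM/LowerNil.
- move=> A; apply: indM => [|a x z Px Pz|x wx]; last exact: wordE.
  + by rewrite la0r mem0v.
  + by rewrite laDr memvD // memvZ.
- apply: indM => [|a x z /= trx trz|x]; first by rewrite /= mxtrace0.
    by rewrite mxtraceD mxtraceZ trx trz mulr0 addr0.
  case=> [|i j y _ _] /=; last by rewrite /ad_fun raddfB /= mxtrace_mulC subrr.
  rewrite /mxtrace big1 // => k _; rewrite !mxE.
  by case: k => [[|k] hk] //=; rewrite -!val_eqE /= andbF.
- move=> y yM wy.
  have [c [s [hs def_y]]] : exists c (s : seq (V * 'M[K]_n)),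
      (forall z, z \in s -> exists2 mu, mu != th & weight P mu z) /\
      y = c *: x0 + \sum_(z <- s) z.
    move: y yM {wy}; apply: indM => [|a x z|x].
    + by exists 0, [::]; split=> //; rewrite big_nil scale0r addr0.
    + move=> [c [s [hs ->]]] [d [t [ht ->]]].
      exists (a * c + d), ([seq a *: u | u <- s] ++ t); split.
        move=> u; rewrite mem_cat => /orP[/mapP[u' /hs[mu ne wu] ->]|/ht//].
        by exists mu => //; apply: weightZ.
      rewrite big_cat big_map -scaler_sumr /= scalerDr scalerDl scalerA -!addrA.
      by congr (_ + _); rewrite addrCA.
    + move=> /lower_word_weight[mu [wx [->|hmu]]].
        by exists 1, [::]; split=> //; rewrite big_nil scale1r addr0.
      exists 0, [:: x]; split; last by rewrite big_seq1 scale0r add0r.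
      move=> u; rewrite inE => /eqP->; exists mu => //.
      by apply: contraTneq hmu => ->; rewrite ltxx.
  exists c; apply/eqP; rewrite -subr_eq0; apply/eqP.
  apply: (weight_sep (f := id) _ hs).
    by rewrite -scaleNr; apply: weightD => //; apply: weightZ.
  by rewrite def_y addrAC subrr add0r.
Qed.

(** The module M of exists_graph is the graph of an isomorphism from V onto sl_n.
    Its intersections with the two summands are stable; the one with V is zero by
    irreducibility because (w, 0) is not in M, the one with sl_n because an ideal
    of sl_n that does not contain E_0max is zero. Its projections are onto for
    the same reasons. *)
Lemma iso_traceless_of_highest : exists phi : V -> 'M[K]_n,
  [/\ linear phi, forall x, phi x = 0 -> x = 0, forall x, \tr (phi x) = 0,
      forall A, \tr A = 0 -> exists x, phi x = A
    & forall A x, phi (e A x) = A *m phi x - phi x *m A].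
Proof.
(* wM and EM: neither (w, 0) nor (0, E_0max), both of top weight, is a multiple
   of (w, E_0max). *)
have [M [x0M stabM trM thM]] := exists_graph.
have dom : o0 != om by [].
have E0 : E o0 om != 0.
  by apply/eqP => /matrixP/(_ o0 om)/eqP; rewrite !mxE !eqxx oner_eq0.
have wM : (w, 0) \notin M.
  apply/negP => /thM[|c [cw /eqP]].
    by apply: weight_prod => //; apply: weight0.
  rewrite eq_sym scaler_eq0 (negPf E0) orbF => /eqP c0.
  by move: cw; rewrite c0 scale0r => /eqP; rewrite (negPf w0).
have EM : (0, E o0 om) \notin M.
  apply/negP => /thM[|c [/eqP cw] cE].
    by apply: weight_prod; [apply: weight0|apply: weight_ad].
  move: cw; rewrite eq_sym scaler_eq0 (negPf w0) orbF => /eqP c0.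
  by move/eqP: cE; rewrite c0 scale0r (negPf E0).
have injM x : (x, 0) \in M -> x = 0.
  have [||U UP] := @vspace_of_linear_pred K V (fun x => (x, 0) \in M).
  - exact: mem0v.
  - move=> a y z yM zM; have -> : (a *: y + z, 0 : 'M[K]_n) = a *: (y, 0) + (z, 0).
      by congr pair; rewrite /= scaler0 addr0.
    by rewrite memvD // memvZ.
  - have [A y /UP yM|U0|UT] := irr (U := U).
    + by apply/UP; have := stabM A _ yM; rewrite /= /ad_fun mulmx0 mul0mx subrr.
    + by move/UP; rewrite U0 memv0 => /eqP.
    + by case/negP: wM; apply/UP; rewrite UT memvf.
have totM x : exists A, (x, A) \in M.
  have [||U UP] := @vspace_of_linear_pred K V (fun x => exists A, (x, A) \in M).
  - by exists 0; apply: mem0v.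
  - move=> a y z [A yM] [B zM]; exists (a *: A + B).
    have -> : (a *: y + z, a *: A + B) = a *: (y, A) + (z, B) by [].
    by rewrite memvD // memvZ.
  - have [A y /UP[B yM]|U0|UT] := irr (U := U).
    + by apply/UP; exists (ad_fun A B); apply: stabM yM.
    + have /UP : exists A, (w, A) \in M by exists (E o0 om).
      by rewrite U0 memv0 (negPf w0).
    + by apply/UP; rewrite UT memvf.
have funM A : (0, A) \in M -> A = 0.
  move=> AM; apply/eqP/negP => /negP A0; case/negP: EM.
  apply: (ad_stable_delta_of_nonscalar (U := fun A => (0, A) \in M)
            _ _ _ dom (trM _ AM) A0 AM).
  - exact: mem0v.
  - move=> a X Y XM YM.
    have -> : (0, a *: X + Y) = a *: (0, X) + (0, Y) :> V * 'M[K]_n.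
      by congr pair; rewrite /= scaler0 addr0.
    by rewrite memvD // memvZ.
  - by move=> B X XM; have := stabM B _ XM; rewrite /= la0r.
have [phi phiM] := choice totM.
have uniq x A : (x, A) \in M -> phi x = A.
  move=> xM; apply/eqP; rewrite -subr_eq0; apply/eqP/funM.
  have -> : (0, phi x - A) = (x, phi x) - (x, A) by congr pair; rewrite /= subrr.
  exact: memvB (phiM x) xM.
exists phi; split.
- by move=> a x y; apply: uniq; apply: (memvD (memvZ a (phiM x)) (phiM y)).
- by move=> x phix; apply: injM; rewrite -phix; apply: phiM.
- by move=> x; exact: (trM _ (phiM x)).
- move=> A trA.
  suff [x xM] : exists x, (x, A) \in M by exists x; apply: uniq.
  apply: (ad_stable_traceless (U := fun A => exists x, (x, A) \in M) _ _ _ dom _ trA).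
  + by exists 0; apply: mem0v.
  + by move=> a X Y [x xM] [y yM]; exists (a *: x + y); apply: (memvD (memvZ a xM) yM).
  + by move=> B X [x xM]; exists (e B x); apply: (stabM B _ xM).
  + by exists w.
- by move=> A x; apply: uniq; apply: (stabM A _ (phiM x)).
Qed.

End HighestWeight.

(** If every E_ij kills v the action on v is trivial. Otherwise some root is a
    weight, hence all are; weight_dichotomy then forbids any weight higher than
    the maximal root, so a vector of that weight is a highest weight vector. *)
Theorem small_zero_weight_classification (v : V) : v != 0 -> weight e 0 v ->
  (forall A, e A v = 0) \/
  exists phi : V -> 'M[K]_n,
  [/\ linear phi, forall x, phi x = 0 -> x = 0, forall x, \tr (phi x) = 0,
      forall A, \tr A = 0 -> exists x, phi x = A
    & forall A x, phi (e A x) = A *m phi x - phi x *m A].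
Proof.
move=> v0 wv.
have [h|/existsNP[i /existsNP[j /not_implyP[ij /eqP vij]]]] :=
    pselect (forall i j, i != j -> e (E i j) v = 0).
  left=> A; rewrite la_entries big1 // => i _; rewrite big1 // => j _.
  have [->|/h->] := eqVneq i j; last by rewrite scaler0.
  by rewrite wv ffunE scale0r scaler0.
right; have w_ij : is_weight (root_wt i j).
  by exists (e (E i j) v) => //; rewrite -[root_wt i j]add0r; apply: weight_E.
have w_0 : is_weight 0 by exists v.
have [w w0 wth] : is_weight th by apply: is_weight_root w_ij.
apply: (iso_traceless_of_highest w0 wth) => k l kl.
apply/eqP/negP => /negP h.
have wkl : is_weight (th + root_wt k l).
  by exists (e (E k l) w) => //; apply: weight_E.
have hkl : height (th + root_wt k l) = m.+1%:Z + (l%:Z - k%:Z).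
  by rewrite heightD !height_root /= subr0.
have [h0|[a [b [ab hab]]]] := weight_dichotomy ij w_ij w_0 wkl.
  have : height (0 : wt) = 0 by rewrite /height big1 ?oppr0 // => c _; rewrite ffunE mul0r.
  by rewrite -h0 hkl; lia.
move: hkl; rewrite hab height_root; have := ltn_ord b; lia.
Qed.

End Classification.

(** * Norms and first-order expansions along 2^-k *)

Section Norm.
Variable R : realType.
Implicit Types (z w : R[i]).

(** The l1 norm on C = R^2 is used instead of the modulus because it needs no
    square root and takes its values in R. *)
Definition cnorm z : R := `|complex.Re z| + `|complex.Im z|.

Lemma cnorm_ge0 z : 0 <= cnorm z.
Proof. by rewrite addr_ge0. Qed.

Lemma cnorm0 : cnorm 0 = 0.
Proof. by rewrite /cnorm /= normr0 addr0. Qed.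

Lemma cnorm_eq0 z : cnorm z = 0 -> z = 0.
Proof.
case: z => a b; rewrite /cnorm /= => /eqP.
by rewrite paddr_eq0 // !normr_eq0 => /andP[/eqP-> /eqP->].
Qed.

Lemma cnormD z w : cnorm (z + w) <= cnorm z + cnorm w.
Proof.
case: z w => [a b] [c d]; rewrite /cnorm /=.
by have := ler_normD a c; have := ler_normD b d; lra.
Qed.

Lemma cnormM z w : cnorm (z * w) <= cnorm z * cnorm w.
Proof.
case: z w => [a b] [c d]; rewrite /cnorm /=.
have := ler_normB (a * c) (b * d); have := ler_normD (a * d) (b * c).
by rewrite !normrM !mulrDl !mulrDr; lra.
Qed.

Lemma cnorm_realM (a : R) z : cnorm (a%:C * z) = `|a| * cnorm z.
Proof.
by case: z => c d; rewrite /cnorm /= !mul0r subr0 addr0 !normrM mulrDr.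
Qed.

Lemma cnormN z : cnorm (- z) = cnorm z.
Proof. by case: z => a b; rewrite /cnorm /= !normrN. Qed.

Lemma cnorm_conj z : cnorm (z^*)%R = cnorm z.
Proof. by case: z => a b; rewrite /cnorm /= normrN. Qed.

Definition mxnorm m n (A : 'M[R[i]]_(m, n)) : R := \sum_i \sum_j cnorm (A i j).

Section OneShape.
Variables m n : nat.
Implicit Types A B : 'M[R[i]]_(m, n).

Lemma mxnorm_ge0 A : 0 <= mxnorm A.
Proof. by do 2!apply: sumr_ge0 => ? _; apply: cnorm_ge0. Qed.

Lemma mxnorm0 : mxnorm (0 : 'M[R[i]]_(m, n)) = 0.
Proof. by rewrite /mxnorm big1 // => i _; rewrite big1 // => j _; rewrite mxE cnorm0. Qed.

Lemma cnorm_le_mxnorm A i j : cnorm (A i j) <= mxnorm A.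
Proof.
rewrite /mxnorm (bigD1 i) //= (bigD1 j) //= -addrA lerDl addr_ge0 //.
  by apply: sumr_ge0 => ? _; apply: cnorm_ge0.
by do 2!apply: sumr_ge0 => ? _; apply: cnorm_ge0.
Qed.

Lemma mxnorm_eq0 A : mxnorm A = 0 -> A = 0.
Proof.
move=> A0; apply/matrixP => i j; rewrite mxE; apply: cnorm_eq0; apply/eqP.
by rewrite eq_le cnorm_ge0 -A0 cnorm_le_mxnorm.
Qed.

Lemma mxnormD A B : mxnorm (A + B) <= mxnorm A + mxnorm B.
Proof.
rewrite /mxnorm -big_split; apply: ler_sum => i _; rewrite -big_split.
by apply: ler_sum => j _; rewrite mxE cnormD.
Qed.

Lemma mxnormN A : mxnorm (- A) = mxnorm A.
Proof. by do 2!apply: eq_bigr => ? _; rewrite mxE cnormN. Qed.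

Lemma mxnormB A B : mxnorm (A - B) <= mxnorm A + mxnorm B.
Proof. by rewrite -(mxnormN B) mxnormD. Qed.

Lemma mxnormZ (a : R) A : mxnorm (a%:C *: A) = `|a| * mxnorm A.
Proof.
rewrite mulr_sumr; apply: eq_bigr => i _; rewrite mulr_sumr.
by apply: eq_bigr => j _; rewrite mxE cnorm_realM.
Qed.

Lemma mxnormZ_le z A : mxnorm (z *: A) <= cnorm z * mxnorm A.
Proof.
rewrite mulr_sumr; apply: ler_sum => i _; rewrite mulr_sumr.
by apply: ler_sum => j _; rewrite mxE cnormM.
Qed.

Lemma mxnorm_sum (I : Type) (s : seq I) (F : I -> 'M[R[i]]_(m, n)) :
  mxnorm (\sum_(i <- s) F i) <= \sum_(i <- s) mxnorm (F i).
Proof.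
elim/big_rec2: _ => [|i b A _ h]; first by rewrite mxnorm0.
by apply: le_trans (mxnormD _ _) _; rewrite lerD2l.
Qed.

End OneShape.

Lemma mxnormM m n p (A : 'M[R[i]]_(m, n)) (B : 'M[R[i]]_(n, p)) :
  mxnorm (A *m B) <= mxnorm A * mxnorm B.
Proof.
rewrite mulr_suml; apply: ler_sum => i _.
have le j : cnorm ((A *m B) i j) <= \sum_k cnorm (A i k) * cnorm (B k j).
  rewrite mxE; apply: le_trans (_ : _ <= \sum_k cnorm (A i k * B k j)) _.
    elim/big_rec2: _ => [|k b c _ h]; first by rewrite cnorm0.
    by apply: le_trans (cnormD _ _) _; rewrite lerD2l.
  by apply: ler_sum => k _; apply: cnormM.
apply: le_trans (ler_sum _ (fun j _ => le j)) _; rewrite exchange_big mulr_suml /=.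
apply: ler_sum => k _; rewrite -mulr_sumr ler_wpM2l ?cnorm_ge0 //.
by rewrite /mxnorm (bigD1 k) //= lerDl; do 2!apply: sumr_ge0 => ? _; apply: cnorm_ge0.
Qed.

Lemma mxnorm_adj m n (A : 'M[R[i]]_(m, n)) : mxnorm (A^t*) = mxnorm A.
Proof.
rewrite /mxnorm exchange_big; apply: eq_bigr => i _; apply: eq_bigr => j _.
by rewrite !mxE cnorm_conj.
Qed.

Lemma mxnorm_linear m n p q (L : {linear 'M[R[i]]_(m, n) -> 'M[R[i]]_(p, q)}) :
  exists2 K : R, 0 <= K & forall A, mxnorm (L A) <= K * mxnorm A.
Proof.
exists (\sum_i \sum_j mxnorm (L (delta_mx i j))).
  by do 2!apply: sumr_ge0 => ? _; apply: mxnorm_ge0.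
move=> A; rewrite {1}(matrix_sum_delta A) linear_sum mulr_suml.
apply: le_trans (mxnorm_sum _ _) _; apply: ler_sum => i _.
rewrite linear_sum mulr_suml; apply: le_trans (mxnorm_sum _ _) _.
apply: ler_sum => j _; rewrite linearZ; apply: le_trans (mxnormZ_le _ _) _.
by rewrite mulrC ler_wpM2l ?mxnorm_ge0 // cnorm_le_mxnorm.
Qed.

Definition eps (k : nat) : R := 2^-1 ^+ k.

Lemma eps_gt0 k : 0 < eps k.
Proof. by rewrite exprn_gt0 // invr_gt0. Qed.

Lemma eps_ge0 k : 0 <= eps k.
Proof. exact/ltW/eps_gt0. Qed.

Lemma eps_le1 k : eps k <= 1.
Proof. by rewrite exprn_ile1 ?invr_ge0 // invf_le1 // ler1n. Qed.

Lemma epsS k : eps k = eps k.+1 * 2.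
Proof. by rewrite /eps exprS mulrAC mulVf ?mul1r. Qed.

Lemma eps_pow2 k : eps k * (2 ^ k)%:R = 1.
Proof. by rewrite /eps natrX -exprMn mulVf ?expr1n. Qed.

Lemma eps_le k l : (k <= l)%N -> eps l <= eps k.
Proof.
move=> kl; rewrite /eps -(subnK kl) exprD ler_piMl ?exprn_ge0 ?invr_ge0 //.
exact: eps_le1.
Qed.

Lemma eps_small (d : R) : 0 < d -> exists k0, forall k, (k0 <= k)%N -> eps k < d.
Proof.
move=> d0; have [k0 hk0] : exists k0 : nat, d^-1 < k0%:R.
  by exists (Num.trunc d^-1).+1; rewrite truncnS_gt.
exists k0 => k k0k; apply: le_lt_trans (eps_le k0k) _.
have : k0%:R < (2 ^ k0)%:R :> R by rewrite ltr_nat ltn_expl.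
move=> /(lt_trans hk0); rewrite -(ltr_pM2l (eps_gt0 k0)) eps_pow2.
by rewrite -(ltr_pM2r d0) mul1r -mulrA mulVf ?mulr1 // gt_eqF.
Qed.

(** Archimedean principle behind all the passages to the limit below. *)
Lemma le_eps0 (a C : R) k0 : (forall k, (k0 <= k)%N -> a <= C * eps k) -> a <= 0.
Proof.
move=> h; rewrite leNgt; apply/negP => a0.
have C0 : 0 < C.
  have := lt_le_trans a0 (h _ (leqnn _)).
  by rewrite pmulr_lgt0 ?eps_gt0.
have [k1 hk1] := eps_small (divr_gt0 a0 C0).
have := hk1 _ (leq_maxr k0 k1); have := h _ (leq_maxl k0 k1).
by rewrite ltr_pdivlMr // mulrC => h1 /lt_le_trans/(_ h1); rewrite ltxx.
Qed.

(** u_k = P + 2^-k X + O(4^-k): the sequence u has value P and velocity X at the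
    times 2^-k. Such dyadic expansions replace differentiation along curves. *)
Definition jet m n (u : nat -> 'M[R[i]]_(m, n)) P X :=
  exists C k0, forall k, (k0 <= k)%N ->
    mxnorm (u k - P - (eps k)%:C *: X) <= C * (eps k) ^+ 2.

Lemma jet_cst m n (P : 'M[R[i]]_(m, n)) : jet (fun=> P) P 0.
Proof.
exists 0, 0%N => k _; rewrite subrr scaler0 subr0 mxnorm0 mul0r //.
Qed.

Lemma jet_affine m n (P X : 'M[R[i]]_(m, n)) : jet (fun k => P + (eps k)%:C *: X) P X.
Proof.
by exists 0, 0%N => k _; rewrite [P + _]addrC addrK subrr mxnorm0 mul0r.
Qed.

Lemma jet_ext m n (u v : nat -> 'M[R[i]]_(m, n)) P X :
  (forall k, u k = v k) -> jet u P X -> jet v P X.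
Proof.
by move=> uv [C [k0 h]]; exists C, k0 => k /h; rewrite uv.
Qed.

Lemma eps_sq_le (C : R) k : C * eps k ^+ 2 <= `|C| * eps k.
Proof.
apply: le_trans (_ : `|C| * eps k ^+ 2 <= _).
  by rewrite ler_wpM2r ?exprn_ge0 ?eps_ge0 ?ler_norm.
by rewrite ler_wpM2l // expr2 ler_piMl ?eps_ge0 ?eps_le1.
Qed.

Lemma jet_bounded m n (u : nat -> 'M[R[i]]_(m, n)) P X : jet u P X ->
  exists C k0, 0 <= C /\ forall k, (k0 <= k)%N -> mxnorm (u k - P) <= C * eps k.
Proof.
move=> [C [k0 h]]; exists (`|C| + mxnorm X), k0; split.
  by rewrite addr_ge0 ?mxnorm_ge0.
move=> k /h {}h; rewrite -[u k - P](subrK ((eps k)%:C *: X)).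
apply: le_trans (mxnormD _ _) _; rewrite mxnormZ ger0_norm ?eps_ge0 // mulrDl.
by rewrite lerD ?[mxnorm X * _]mulrC // (le_trans h) ?eps_sq_le.
Qed.

(** Leibniz rule. *)
Lemma jetM m n p (u : nat -> 'M[R[i]]_(m, n)) (v : nat -> 'M[R[i]]_(n, p)) P X Q Y :
  jet u P X -> jet v Q Y -> jet (fun k => u k *m v k) (P *m Q) (P *m Y + X *m Q).
Proof.
move=> ju jv; have [B [k2 [B0 hB]]] := jet_bounded jv.
case: ju jv => C [k0 h] [D [k1 g]].
exists (`|C| * (mxnorm Q + B) + mxnorm P * `|D| + mxnorm X * B),
  (maxn k0 (maxn k1 k2)) => k.
rewrite !geq_max => /and3P[/h {}h /g {}g /hB {}hB].
have e0 := eps_ge0 k; have e1 := eps_le1 k; set e := eps k in h g hB e0 e1 *.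
have -> : u k *m v k - P *m Q - e%:C *: (P *m Y + X *m Q) =
    (u k - P - e%:C *: X) *m v k + P *m (v k - Q - e%:C *: Y)
     + e%:C *: (X *m (v k - Q)).
  rewrite !mulmxBl !mulmxBr scalerDr scalerBr -!scalemxAl -!scalemxAr.
  move: (u k *m v k) (P *m Q) (P *m Y) (X *m Q) (P *m v k) (X *m v k).
  by move=> a b c d f g'; apply/matrixP => i j; rewrite !mxE; ring.
have vb : mxnorm (v k) <= mxnorm Q + B.
  rewrite -[v k](subrK Q) addrC; apply: le_trans (mxnormD _ _) _; rewrite lerD2l.
  by rewrite (le_trans hB) // ler_piMr.
apply: le_trans (mxnormD _ _) _; rewrite mulrDl lerD //.
  apply: le_trans (mxnormD _ _) _; rewrite mulrDl lerD //.
    apply: le_trans (mxnormM _ _) _; rewrite mulrAC ler_pM ?mxnorm_ge0 //.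
    by apply: le_trans h _; rewrite ler_wpM2r ?exprn_ge0 ?ler_norm.
  apply: le_trans (mxnormM _ _) _; rewrite -mulrA ler_wpM2l ?mxnorm_ge0 //.
  by apply: le_trans g _; rewrite ler_wpM2r ?exprn_ge0 ?ler_norm.
rewrite mxnormZ ger0_norm //; apply: le_trans (_ : e * (mxnorm X * (B * e)) <= _).
  by rewrite ler_wpM2l // (le_trans (mxnormM _ _)) // ler_wpM2l ?mxnorm_ge0.
by rewrite expr2 mulrCA [e * (B * e)]mulrCA mulrA.
Qed.

Lemma jet_linear m n p q (L : {linear 'M[R[i]]_(m, n) -> 'M[R[i]]_(p, q)}) u P X :
  jet u P X -> jet (fun k => L (u k)) (L P) (L X).
Proof.
move=> [C [k0 h]]; have [K K0 hK] := mxnorm_linear L; exists (K * C), k0 => k /h {}h.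
rewrite -linearZ -!linearB (le_trans (hK _)) // -mulrA ler_wpM2l //.
Qed.

Lemma jet_adj m n (u : nat -> 'M[R[i]]_(m, n)) P X :
  jet u P X -> jet (fun k => (u k)^t*) (P^t*) (X^t*).
Proof.
move=> [C [k0 h]]; exists C, k0 => k /h {}h.
have -> : (u k)^t* - P^t* - (eps k)%:C *: X^t* = (u k - P - (eps k)%:C *: X)^t*.
  apply/matrixP => i j; rewrite !mxE !rmorphB rmorphM /=; congr (_ - _ * _).
  by apply/esym/conjc_real.
by rewrite mxnorm_adj.
Qed.

Lemma jet_uniq m n (u : nat -> 'M[R[i]]_(m, n)) P X Y :
  jet u P X -> jet u P Y -> X = Y.
Proof.
move=> [C [k0 h]] [D [k1 g]]; apply/eqP; rewrite -subr_eq0; apply/eqP/mxnorm_eq0.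
apply/eqP; rewrite eq_le mxnorm_ge0 andbT.
apply: (@le_eps0 _ (C + D) (maxn k0 k1)) => k.
rewrite geq_max => /andP[/h {}h /g {}g].
rewrite -(ler_pM2l (eps_gt0 k)) mulrCA -expr2 -[X in X * _ <= _]ger0_norm ?eps_ge0 //.
rewrite -mxnormZ mulrDl [leRHS]addrC.
have -> : (eps k)%:C *: (X - Y) =
    (u k - P - (eps k)%:C *: Y) - (u k - P - (eps k)%:C *: X).
  by apply/matrixP => i j; rewrite !mxE; ring.
by rewrite (le_trans (mxnormB _ _)) // lerD.
Qed.

End Norm.

(** * One-parameter subgroups of SU_n *)

Section Cis.
Variable R : realType.
Implicit Types x y : R.

Lemma mean_value_bound (f df : R -> R) x B :
  (forall y, is_derive y 1 f (df y)) ->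
  (forall c, `|c| <= `|x| -> `|df c| <= B) -> `|f x - f 0| <= B * `|x|.
Proof.
move=> fd dfB; have cf a b : {within `[a, b]%classic, continuous f}.
  apply: continuous_subspaceT => y; apply/differentiable_continuous/derivable1_diffP.
  exact: ex_derive.
have [x0|x0] := leP 0 x.
  have [c cin ->] := MVT_segment x0 (fun y _ => fd y) (@cf 0 x).
  rewrite subr0 normrM ler_wpM2r // dfB //.
  by move: cin; rewrite in_itv /= => /andP[c0 cx]; rewrite !ger0_norm.
have [c cin e] := MVT_segment (ltW x0) (fun y _ => fd y) (@cf x 0).
rewrite distrC e sub0r normrM normrN ler_wpM2r // dfB //.
by move: cin; rewrite in_itv /= => /andP[c0 cx]; rewrite !ler0_norm ?lerN2 // ltW.
Qed.

Lemma abs_sin_le x : `|sin x| <= `|x|.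
Proof.
have := @mean_value_bound sin cos x 1 (fun y => is_derive_sin y).
rewrite sin0 subr0 mul1r; apply=> c _.
exact: cos_max.
Qed.

Lemma abs_cos_sub1_le x : `|cos x - 1| <= x ^+ 2.
Proof.
have := @mean_value_bound cos (fun y => - sin y) x `|x| (fun y => is_derive_cos y).
rewrite cos0 -expr2 real_normK ?num_real //; apply=> c cx.
by rewrite normrN (le_trans (abs_sin_le c)).
Qed.

Lemma abs_sin_sub_le x : `|sin x - x| <= x ^+ 2.
Proof.
have d y : is_derive y 1 (fun z : R => sin z - z) (cos y - 1).
  exact: (is_deriveB (is_derive_sin y) (is_derive_id y 1)).
have := @mean_value_bound (fun z => sin z - z) (fun y => cos y - 1) x `|x| d.
rewrite sin0 !subr0 -expr2 real_normK ?num_real //; apply=> c cx.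
have := @mean_value_bound cos (fun y => - sin y) c 1 (fun y => is_derive_cos y).
rewrite cos0 mul1r => h; apply: le_trans cx; apply: h => y _.
by rewrite normrN sin_max.
Qed.

(** e^(ix). *)
Definition cis x : R[i] := cos x +i* sin x.

Lemma cis0 : cis 0 = 1.
Proof. by rewrite /cis cos0 sin0. Qed.

Lemma cisD x y : cis (x + y) = cis x * cis y.
Proof. rewrite /cis cosD sinD.
by apply/eqP; rewrite eq_complex /=; apply/andP; split; apply/eqP; ring. Qed.

Lemma cis_conj x : ((cis x)^*)%R = cis (- x).
Proof. by rewrite /cis cosN sinN. Qed.

Lemma cis_jet x : cnorm (cis x - 1 - (0 +i* x)) <= 2 * x ^+ 2.
Proof.
rewrite /cnorm /= !subr0 (_ : 2 * x ^+ 2 = x ^+ 2 + x ^+ 2); last by ring.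
by rewrite lerD ?abs_cos_sub1_le ?abs_sin_sub_le.
Qed.

Lemma cis_onto (z : R[i]) : z * (z^*)%R = 1 -> exists x, z = cis x.
Proof.
case: z => a b; rewrite /GRing.mul /GRing.one /= => -[ab _].
have ab1 : a ^+ 2 + b ^+ 2 = 1 by rewrite !expr2 -ab; ring.
have ha : -1 <= a <= 1.
  by rewrite -ler_norml -(@ler_pXn2r _ 2) ?nnegrE // expr1n real_normK ?num_real //
    -ab1 lerDl sqr_ge0.
have sb : sin (acos a) = `|b|.
  by rewrite sin_acos // -ab1 addrAC subrr add0r sqrtr_sqr.
have ca : cos (acos a) = a by rewrite acosK // in_itv.
have [b0|b0] := leP 0 b.
  by exists (acos a); rewrite /cis ca sb ger0_norm.
exists (- acos a); rewrite /cis cosN sinN ca sb ltr0_norm // opprK //.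
Qed.

End Cis.

Section OneParam.
Variables (R : realType) (n : nat).
Implicit Types (P X : 'M[R[i]]_n) (lam : 'I_n -> R).

(** The Lie algebra su_n. *)
Definition su X := X^t* = - X /\ \tr X = 0.

(** The restriction of the one-parameter subgroup exp(tX) to the times 2^-k,
    characterised by successive square roots and by the velocity X. *)
Definition exp_seq (g : nat -> SU R n) X :=
  (forall k, g k = (g k.+1 * g k.+1)%g) /\ jet (fun k => SU_mx (g k)) 1%:M X.

Definition diagd (d : 'I_n -> R[i]) : 'M[R[i]]_n := diag_mx (\row_k d k).

Lemma diagdM d d' : diagd d *m diagd d' = diagd (fun k => d k * d' k).
Proof. by rewrite /diagd mulmx_diag; congr diag_mx; apply/rowP => k; rewrite !mxE. Qed.

Lemma diagdB d d' : diagd d - diagd d' = diagd (fun k => d k - d' k).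
Proof. by rewrite /diagd -linearB; congr diag_mx; apply/rowP => k; rewrite !mxE. Qed.

Lemma diagdZ a d : a *: diagd d = diagd (fun k => a * d k).
Proof. by rewrite /diagd -linearZ; congr diag_mx; apply/rowP => k; rewrite !mxE. Qed.

Lemma diagd_adj d : (diagd d)^t* = diagd (fun k => (d k)^*%R).
Proof.
by rewrite /diagd tr_diag_mx map_diag_mx; congr diag_mx; apply/rowP => k; rewrite !mxE.
Qed.

Lemma diagd1 : diagd (fun=> 1) = 1%:M.
Proof.
by rewrite /diagd -diag_const_mx; congr diag_mx; apply/rowP => k; rewrite !mxE.
Qed.

(** The matrix with orthonormal eigenbasis P and eigenvalues d. *)
Definition udiag P (d : 'I_n -> R[i]) : 'M[R[i]]_n := P^t* *m (diagd d *m P).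

Variable P : 'M[R[i]]_n.
Hypothesis uP : P \is unitarymx.

Let PPt : P *m P^t* = 1%:M. Proof. exact/unitarymxP. Qed.
Let PtP : P^t* *m P = 1%:M. Proof. exact: mulmx1C. Qed.

Lemma udiag1 : udiag P (fun=> 1) = 1%:M.
Proof. by rewrite /udiag diagd1 mul1mx. Qed.

Lemma udiagM d d' : udiag P d *m udiag P d' = udiag P (fun k => d k * d' k).
Proof.
by rewrite /udiag -diagdM -!mulmxA (mulmxA P) PPt mul1mx.
Qed.

Lemma udiag_adj d : (udiag P d)^t* = udiag P (fun k => (d k)^*%R).
Proof. by rewrite /udiag !trmx_mul !map_mxM trmxCK diagd_adj mulmxA. Qed.

Lemma udiagB d d' : udiag P d - udiag P d' = udiag P (fun k => d k - d' k).
Proof. by rewrite /udiag -mulmxBr -mulmxBl diagdB. Qed.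

Lemma udiagZ a d : a *: udiag P d = udiag P (fun k => a * d k).
Proof. by rewrite /udiag scalemxAr scalemxAl diagdZ. Qed.

Lemma udiag_det d : \det (udiag P d) = \prod_k d k.
Proof.
rewrite /udiag !det_mulmx mulrCA -det_mulmx PtP det1 mulr1 det_diag.
by apply: eq_bigr => k _; rewrite mxE.
Qed.

Lemma udiag_tr d : \tr (udiag P d) = \sum_k d k.
Proof.
rewrite /udiag mxtrace_mulC -mulmxA PPt mulmx1 mxtrace_diag.
by apply: eq_bigr => k _; rewrite mxE.
Qed.

Lemma mxnorm_udiag d B : (forall k, cnorm (d k) <= B) ->
  mxnorm (udiag P d) <= mxnorm P * mxnorm P * (n%:R * B).
Proof.
move=> dB; apply: le_trans (mxnormM _ _) _; rewrite mxnorm_adj -mulrA ler_wpM2l ?mxnorm_ge0 //.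
apply: le_trans (mxnormM _ _) _; rewrite mulrC ler_wpM2l ?mxnorm_ge0 //.
have -> : n%:R * B = \sum_(k < n) B by rewrite sumr_const card_ord mulr_natl.
apply: ler_sum => k _.
rewrite (bigD1 k) //= big1 => [|j /negPf jk]; last first.
  by rewrite !mxE eq_sym jk mulr0n cnorm0.
by rewrite addr0 !mxE eqxx mulr1n.
Qed.

(** exp(tX) is computed in an eigenbasis of X. *)
Lemma exp_seq_udiag lam : \sum_k lam k = 0 ->
  exists g, exp_seq g (udiag P (fun k => 0 +i* lam k)) /\
    forall k, SU_mx (g k) = udiag P (fun j => cis (eps R k * lam j)).
Proof.
move=> lam0; pose ex (t : R) := udiag P (fun k => cis (t * lam k)).
have exP t : (ex t \is unitarymx) && (\det (ex t) == 1).
  apply/andP; split.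
    apply/unitarymxP; rewrite /ex udiag_adj udiagM -udiag1; congr (udiag P _).
    by apply/funext => k; rewrite cis_conj -cisD subrr cis0.
  rewrite /ex udiag_det -(big_morph (fun x => cis x) (@cisD R) (@cis0 R)).
  by rewrite -mulr_sumr lam0 mulr0 cis0.
exists (fun k => MkSU (exP (eps R k))); split=> //; split=> [k|].
  apply/val_inj; rewrite /= /ex udiagM; congr (udiag P _); apply/funext => j.
  by rewrite -cisD -mulrDl epsS mulr_natr mulr2n.
pose B := \sum_k (2 * lam k ^+ 2).
exists (mxnorm P * mxnorm P * (n%:R * B)), 0%N => k _ /=.
rewrite /ex -udiag1 udiagZ !udiagB.
apply: le_trans (mxnorm_udiag (B := B * eps R k ^+ 2) _) _; last by rewrite !mulrA.
move=> j.
have -> : (eps R k)%:C * (0 +i* lam j) = 0 +i* (eps R k * lam j).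
  by apply/eqP; rewrite eq_complex /=; apply/andP; split; apply/eqP; ring.
apply: le_trans (cis_jet _) _; rewrite exprMn mulrCA [leRHS]mulrC ler_wpM2l ?sqr_ge0 //.
rewrite /B (bigD1 j) //= lerDl; apply: sumr_ge0 => i _.
by rewrite mulr_ge0 ?sqr_ge0.
Qed.

Lemma udiag_inj d d' : udiag P d = udiag P d' -> forall k, d k = d' k.
Proof.
move=> /(congr1 (fun A => P *m A *m P^t*)).
rewrite /udiag !(mulmxA P) !PPt !mul1mx -!mulmxA !PPt !mulmx1.
by move=> /matrixP h k; have := h k k; rewrite !mxE eqxx !mulr1n.
Qed.

Lemma su_udiag_imag lam : \sum_k lam k = 0 -> su (udiag P (fun k => 0 +i* lam k)).
Proof.
move=> lam0; split.
  rewrite udiag_adj -scaleN1r udiagZ; apply: (congr1 (udiag P)); apply/funext => k.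
  by apply/eqP; rewrite eq_complex /=; apply/andP; split; apply/eqP; ring.
rewrite udiag_tr; have -> : \sum_k (0 +i* lam k : R[i]) = 0 +i* \sum_k lam k.
  by elim/big_rec2: _ => // k a b _ ->; rewrite /GRing.add /= addr0.
by rewrite lam0.
Qed.

End OneParam.

Lemma normal_udiag (R : realType) n (X : 'M[R[i]]_n) : X *m X^t* = X^t* *m X ->
  exists2 P, P \is unitarymx & exists d, X = udiag P d.
Proof.
move=> /normalmxP/orthomx_spectralP; have := spectral_unitarymx X.
move: (spectralmx X) (spectral_diag X) => P d uP ->; exists P => //.
exists (d 0); rewrite /udiag invmx_unitary // mulmxA.
suff -> : diagd (d 0) = diag_mx d by [].
by rewrite /diagd; congr diag_mx; apply/rowP => k; rewrite !mxE.
Qed.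

Lemma exp_seq_exists (R : realType) n (X : 'M[R[i]]_n) : su X ->
  exists g, exp_seq g X.
Proof.
move=> [adjX trX]; have [|P uP [d def_X]] := @normal_udiag _ _ X.
  by rewrite adjX mulmxN mulNmx.
have im k : d k = 0 +i* complex.Im (d k).
  have : udiag P (fun k => (d k)^*%R) = udiag P (fun k => (-1) * d k).
    by rewrite -udiagZ // -udiag_adj // -def_X adjX scaleN1r.
  move/udiag_inj => /(_ uP k); rewrite mulN1r; case: (d k) => a b /eqP.
  rewrite eq_complex /= => /andP[/eqP h _].
  by congr Complex; lra.
have def_X' : X = udiag P (fun k => 0 +i* complex.Im (d k)).
  by rewrite def_X; congr (udiag P _); apply/funext.
have [|g [hg _]] := exp_seq_udiag uP (lam := fun k => complex.Im (d k)).
  by rewrite -raddf_sum -(udiag_tr uP) -def_X trX.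
by exists g; rewrite def_X'.
Qed.

(** The exponential map of SU_n is onto: diagonalise g with eigenvalues
    exp(i mu_k). The sum S of the mu_k satisfies exp(i S) = 1, so that subtracting
    S from one of them leaves g unchanged and makes the generator traceless. *)
Lemma exp_seq_onto (R : realType) n (g : SU R n) : (0 < n)%N ->
  exists X e, [/\ su X, exp_seq e X & e 0%N = g].
Proof.
move=> n0; case: g => g gP; have /andP[/unitarymxP ug /eqP dg] := gP.
have ug' := mulmx1C ug.
have [|P uP [z def_g]] := @normal_udiag _ _ g; first by rewrite ug ug'.
have /choice[mu hmu] : forall k, exists x, z k = cis x.
  move=> k; apply: cis_onto; move: ug.
  by rewrite def_g udiag_adj // udiagM // -(udiag1 uP) => /udiag_inj; apply.
pose i0 := Ordinal n0; pose S := \sum_k mu k.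
have S1 : cis S = 1.
  rewrite /S (big_morph (fun x => cis x) (@cisD R) (@cis0 R)).
  by rewrite -(eq_bigr _ (fun k _ => hmu k)) -(udiag_det uP) -def_g.
(* Correct one eigenvalue exponent by the total S. *)
pose lam k := mu k - (if k == i0 then S else 0).
have lam0 : \sum_k lam k = 0.
  by rewrite sumrB -big_mkcond /= big_pred1_eq subrr.
have lamz k : cis (lam k) = z k.
  rewrite hmu /lam; case: eqP => _; last by rewrite subr0.
  by rewrite cisD -cis_conj S1 rmorph1 mulr1.
have [e [he e0]] := exp_seq_udiag uP lam0.
exists (udiag P (fun k => 0 +i* lam k)), e; split=> //; first exact: su_udiag_imag.
apply/val_inj; rewrite /= e0 def_g; apply: (congr1 (udiag P)); apply/funext => k.
by rewrite /eps expr0 mul1r lamz.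
Qed.

(** * Lipschitz continuity of representations *)

Section Limits.
Variable R : realType.

(** A Cauchy criterion with rate: the sequences a_k - 2 C 2^-k and a_k + 2 C 2^-k
    are monotone and adjacent. *)
Lemma geometric_cauchy (a : nat -> R) C k0 :
  (forall k, (k0 <= k)%N -> `|a k.+1 - a k| <= C * eps R k) ->
  exists l, forall k, (k0 <= k)%N -> `|a k - l| <= 2 * C * eps R k.
Proof.
(* x increases, y decreases and x <= y; any point in between is the limit. *)
move=> h; pose x k := a k - 2 * C * eps R k; pose y k := a k + 2 * C * eps R k.
have C0 k : (k0 <= k)%N -> 0 <= C * eps R k.
  by move=> /h; apply: le_trans.
have xS k : (k0 <= k)%N -> x k <= x k.+1.
  by move=> /h; rewrite ler_distl => /andP[h1 _]; rewrite /x; move: h1; rewrite epsS; lra.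
have yS k : (k0 <= k)%N -> y k.+1 <= y k.
  by move=> /h; rewrite ler_distl => /andP[_ h1]; rewrite /y; move: h1; rewrite epsS; lra.
have xm k j : (k0 <= k)%N -> x k <= x (k + j)%N.
  move=> hk; elim: j => [|j IH]; first by rewrite addn0.
  by rewrite addnS (le_trans IH) // xS // (leq_trans hk) // leq_addr.
have ym k j : (k0 <= k)%N -> y (k + j)%N <= y k.
  move=> hk; elim: j => [|j IH]; first by rewrite addn0.
  by rewrite addnS; apply: le_trans IH; rewrite yS // (leq_trans hk) // leq_addr.
have xy k j : (k0 <= k)%N -> (k0 <= j)%N -> x k <= y j.
  move=> hk hj; apply: le_trans (xm k j hk) _; rewrite addnC.
  apply: le_trans (ym j k hj); rewrite /x /y.
  by have := C0 (j + k)%N (leq_trans hj (leq_addr _ _)); lra.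
pose S := [set x k | k in [set k | (k0 <= k)%N]].
have S0 : S !=set0 by exists (x k0), k0 => /=.
exists (sup S) => k hk; rewrite distrC ler_distl.
have -> : a k - 2 * C * eps R k = x k by [].
have -> : a k + 2 * C * eps R k = y k by [].
apply/andP; split.
  apply: ub_le_sup; last by exists k.
  by exists (y k) => _ [j /= hj <-]; apply: xy.
by apply: ge_sup => // _ [j /= hj <-]; apply: xy.
Qed.

(** Successive square roots u_k = u_(k+1)^2 that tend to 1 at rate 2^-k have a
    velocity: with a_k = 2^k (u_k - 1) one has
    a_(k+1) - a_k = - 2^k (u_(k+1) - 1)^2 = O(2^-k). *)
Lemma jet_of_square_roots d (u : nat -> 'M[R[i]]_d) C k0 :
  (forall k, u k = u k.+1 *m u k.+1) ->
  (forall k, (k0 <= k)%N -> mxnorm (u k - 1%:M) <= C * eps R k) ->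
  exists A, jet u 1%:M A.
Proof.
move=> usq uC; pose a k : 'M[R[i]]_d := ((2 ^ k)%:R : R)%:C *: (u k - 1%:M).
have aS k : (k0 <= k)%N -> mxnorm (a k.+1 - a k) <= C ^+ 2 * eps R k.
  move=> hk; have -> : a k.+1 - a k =
      - (((2 ^ k)%:R : R)%:C *: ((u k.+1 - 1%:M) *m (u k.+1 - 1%:M))).
    rewrite /a (usq k) expnS natrM mulrC rmorphM /= -scalerA -scalerBr -scalerN.
    congr (_ *: _); rewrite mulmxBl !mulmxBr mul1mx !mulmx1 rmorph_nat scaler_nat mulr2n.
    by apply/matrixP => i j; rewrite !mxE; ring.
  rewrite mxnormN mxnormZ ger0_norm //.
  have e := uC _ (leqW hk); have e0 := mxnorm_ge0 (u k.+1 - 1%:M).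
  apply: le_trans (_ : _ <= (2 ^ k)%:R * (C * eps R k.+1) ^+ 2) _.
    rewrite ler_wpM2l // (le_trans (mxnormM _ _)) // -expr2.
    by rewrite ler_pXn2r // nnegrE // (le_trans e0).
  rewrite exprMn mulrCA ler_wpM2l ?sqr_ge0 //.
  rewrite expr2 mulrA; have -> : (2 ^ k)%:R * eps R k.+1 = 2^-1.
    by rewrite /eps exprS mulrCA [X in _ * X]mulrC eps_pow2 mulr1.
  have := epsS R k; have := eps_ge0 R k.+1; lra.
have ent (f : R[i] -> R) : (forall z w, f (z - w) = f z - f w) ->
    (forall z, `|f z| <= cnorm z) -> forall i j, exists l, forall k, (k0 <= k)%N ->
    `|f (a k i j) - l| <= 2 * C ^+ 2 * eps R k.
  move=> fB fcnorm i j; apply: geometric_cauchy => k /aS; apply: le_trans.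
  rewrite -fB; apply: le_trans (fcnorm _) _.
  by have := cnorm_le_mxnorm (a k.+1 - a k) i j; rewrite !mxE.
have entR : forall p : 'I_d * 'I_d, exists l, forall k, (k0 <= k)%N ->
    `|complex.Re (a k p.1 p.2) - l| <= 2 * C ^+ 2 * eps R k.
  move=> p; apply: ent => [[? ?] [? ?]//|[b c]]; by rewrite /cnorm lerDl.
have entI : forall p : 'I_d * 'I_d, exists l, forall k, (k0 <= k)%N ->
    `|complex.Im (a k p.1 p.2) - l| <= 2 * C ^+ 2 * eps R k.
  move=> p; apply: ent => [[? ?] [? ?]//|[b c]]; by rewrite /cnorm lerDr.
have [lR hR] := choice entR; have [lI hI] := choice entI.
pose A : 'M[R[i]]_d := \matrix_(i, j) (lR (i, j) +i* lI (i, j)).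
exists A, (\sum_(i < d) \sum_(j < d) (4 * C ^+ 2)), k0 => k hk.
have -> : u k - 1%:M - (eps R k)%:C *: A = (eps R k)%:C *: (a k - A).
  by rewrite scalerBr /a scalerA -rmorphM /= eps_pow2 scale1r.
rewrite mxnormZ ger0_norm ?eps_ge0 // [eps R k ^+ 2]expr2 [leRHS]mulrA [leLHS]mulrC.
rewrite ler_wpM2r ?eps_ge0 //.
rewrite /mxnorm mulr_suml; apply: ler_sum => i _; rewrite mulr_suml.
apply: ler_sum => j _; rewrite !mxE.
have := hR (i, j) k hk; have := hI (i, j) k hk; rewrite /= /a !mxE.
by case: (_ * _) => b c /=; rewrite /cnorm /=; lra.
Qed.

End Limits.

Section Lipschitz.
Variables (R : realType) (n : nat).
Implicit Types g h : SU R n.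

Lemma mxnorm_SU g : mxnorm g <= (n * n * 2)%:R.
Proof.
have /andP[/unitarymxP ug _] := SU_mxP g.
have ent i j : cnorm (g i j) <= 2.
  have : \sum_k (complex.Re (g i k) ^+ 2 + complex.Im (g i k) ^+ 2) = 1.
    have /matrixP/(_ i i) := ug; rewrite !mxE eqxx => /(congr1 (@complex.Re R)).
    rewrite raddf_sum /= => <-; apply: eq_bigr => k _; rewrite !mxE.
    by case: (g i k) => a b /=; rewrite !expr2 mulrN opprK.
  rewrite (bigD1 j) //=; set T := \sum_(k | _) _ => e.
  have T0 : 0 <= T by apply: sumr_ge0 => k _; rewrite addr_ge0 ?sqr_ge0.
  have sq (x : R) : x ^+ 2 <= 1 -> `|x| <= 1.
    by move=> x1; rewrite -(@ler_pXn2r _ 2) ?nnegrE // expr1n real_normK ?num_real.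
  rewrite /cnorm (_ : 2 = 1 + 1) // lerD // sq //.
    by have := sqr_ge0 (complex.Im (g i j)); lra.
  by have := sqr_ge0 (complex.Re (g i j)); lra.
apply: le_trans (_ : _ <= \sum_(i < n) \sum_(j < n) 2) _.
  by apply: ler_sum => i _; apply: ler_sum => j _.
by rewrite !sumr_const !card_ord -mulrnA natrM mulr_natl.
Qed.

Lemma SU_mx_expS g k : SU_mx (g ^+ k.+1)%g = g *m SU_mx (g ^+ k)%g.
Proof. by rewrite expgS. Qed.

Lemma mxnorm_pow_sub1 g k :
  mxnorm (SU_mx (g ^+ k)%g - 1%:M) <= k%:R * ((n * n * 2)%:R * mxnorm (SU_mx g - 1%:M)).
Proof.
elim: k => [|k IH]; first by rewrite expg0 subrr mxnorm0 mul0r.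
rewrite SU_mx_expS; have -> : g *m SU_mx (g ^+ k)%g - 1%:M =
    (SU_mx g - 1%:M) *m SU_mx (g ^+ k)%g + (SU_mx (g ^+ k)%g - 1%:M).
  by rewrite mulmxBl mul1mx addrA subrK.
rewrite (le_trans (mxnormD _ _)) // -natr1 mulrDl mul1r addrC lerD //.
by rewrite (le_trans (mxnormM _ _)) // mulrC ler_wpM2r ?mxnorm_ge0 // mxnorm_SU.
Qed.

Variables (d : nat) (r : SU R n -> 'M[R[i]]_d).
Hypothesis r1 : r 1%g = 1%:M.
Hypothesis rM : forall g h : SU R n, r (g * h)%g = r g *m r h.
Hypothesis r_cont : forall e : R, 0 < e -> exists2 dl : R, 0 < dl &
  forall g, mxnorm (SU_mx g - 1%:M) < dl -> mxnorm (r g - 1%:M) < e.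

(** A continuous homomorphism r is Lipschitz at 1. If g is within x of 1, its
    powers g^k stay close to 1 up to m ~ 1/x, hence so do the r(g)^k, and their
    sum S is close to m. From (r(g) - 1) S = r(g)^m - 1 one gets that
    r(g) - 1 is O(1/m) = O(x). *)
Lemma lipschitz_at1 : exists L dl : R, [/\ 0 <= L, 0 < dl &
  forall g, mxnorm (SU_mx g - 1%:M) < dl ->
    mxnorm (r g - 1%:M) <= L * mxnorm (SU_mx g - 1%:M)].
Proof.
have [|dl dl0 hdl] := r_cont (e := 2^-1); first by rewrite invr_gt0.
pose K : R := (n * n * 2)%:R + 1.
have K0 : 0 < K by rewrite ltr_pwDr.
exists (4 * K / dl), (dl / (2 * K)); split.
- by rewrite !mulr_ge0 ?invr_ge0 // ltW.
- by rewrite divr_gt0 // mulr_gt0.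
move=> g; set x := mxnorm _ => hx.
have x_ge0 : 0 <= x by apply: mxnorm_ge0.
have [x0|x0] := eqVneq x 0.
  have -> : g = 1%g.
    by apply/val_inj/eqP; rewrite -subr_eq0; apply/eqP/mxnorm_eq0.
  by rewrite r1 subrr mxnorm0 x0 mulr0.
have xpos : 0 < x by rewrite lt_def x0.
(* The powers of g up to m = floor y stay in the ball where r is 1/2-close to 1. *)
pose y := dl / (2 * K * x).
have y1 : 1 < y.
  rewrite /y ltr_pdivlMr ?mulr_gt0 // mul1r.
  by move: hx; rewrite ltr_pdivlMr ?mulr_gt0 // mulrC.
pose m := Num.trunc y.
have my : m%:R <= y by rewrite truncn_le // ltW // (lt_trans ltr01).
have ym : y < m.+1%:R by rewrite truncnS_gt.
have m0 : (0 < m)%N by rewrite -(ltr_nat R); move: ym; rewrite -natr1; lra.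
have powK k : (k <= m)%N -> mxnorm (r (g ^+ k)%g - 1%:M) <= 2^-1.
  move=> km; apply/ltW/hdl; apply: le_lt_trans (mxnorm_pow_sub1 g k) _.
  apply: le_lt_trans (_ : y * (K * x) < _).
    apply: ler_pM => //; first by rewrite mulr_ge0.
      by apply: le_trans my; rewrite ler_nat.
    by rewrite ler_wpM2r // lerDl.
  rewrite /y (_ : dl / (2 * K * x) * (K * x) = dl / 2); last first.
    by field; rewrite x0 gt_eqF.
  by lra.
pose S := \sum_(k < m) r (g ^+ k)%g.
have telescope : (r g - 1%:M) *m S = r (g ^+ m)%g - 1%:M.
  rewrite /S; elim: (m) => [|k IH].
    by rewrite big_ord0 mulmx0 expg0 r1 subrr.
  rewrite big_ord_recr /= mulmxDr IH mulmxBl mul1mx -rM -expgS.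
  by rewrite addrC addrA subrK.
have S_near : mxnorm (S - m%:R%:M) <= m%:R * 2^-1.
  have -> : S - m%:R%:M = \sum_(k < m) (r (g ^+ k)%g - 1%:M).
    by rewrite sumrB sumr_const card_ord raddfMn.
  apply: le_trans (mxnorm_sum _ _) _.
  apply: le_trans (_ : _ <= \sum_(k < m) 2^-1) _.
    by apply: ler_sum => k _; apply: powK; apply: ltnW.
  by rewrite sumr_const card_ord mulr_natl.
have key : m%:R * mxnorm (r g - 1%:M) <= 2^-1 + mxnorm (r g - 1%:M) * (m%:R * 2^-1).
  rewrite -[m%:R in leLHS]ger0_norm // -mxnormZ.
  have -> : (m%:R : R)%:C *: (r g - 1%:M) =
      (r (g ^+ m)%g - 1%:M) - (r g - 1%:M) *m (S - m%:R%:M).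
    rewrite mulmxBr telescope subKr mul_mx_scalar rmorph_nat.
    by [].
  rewrite (le_trans (mxnormB _ _)) // lerD ?powK //.
  by rewrite (le_trans (mxnormM _ _)) // ler_wpM2l ?mxnorm_ge0.
have mpos : 0 < m%:R :> R by rewrite ltr0n.
have bound : mxnorm (r g - 1%:M) * m%:R <= 1 by move: key; lra.
have -> : 4 * K / dl * x = 2 / y.
  by rewrite /y; field; rewrite x0 !gt_eqF.
rewrite ler_pdivlMr ?(lt_trans ltr01) //.
apply: le_trans (_ : mxnorm (r g - 1%:M) * (2 * m%:R) <= _).
  rewrite ler_wpM2l ?mxnorm_ge0 //; move: ym; rewrite -natr1.
  have : 1 <= m%:R :> R by rewrite ler1n.
  by lra.
by move: bound; lra.
Qed.

End Lipschitz.

(** * The differential of a representation *)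

Section Su.
Variables (R : realType) (n : nat).
Implicit Types (X Y : 'M[R[i]]_n) (g : SU R n).

Lemma suD X Y : su X -> su Y -> su (X + Y).
Proof.
move=> [aX tX] [aY tY]; split; last by rewrite linearD /= tX tY addr0.
by rewrite linearD /= map_mxD aX aY opprD.
Qed.

Lemma suZ (c : R) X : su X -> su (c%:C *: X).
Proof.
move=> [aX tX]; split; last by rewrite linearZ /= tX mulr0.
rewrite linearZ /= map_mxZ aX scalerN; congr (- (_ *: _)); exact: conjc_real.
Qed.

Lemma suN X : su X -> su (- X).
Proof. by move=> /(suZ (-1)); rewrite rmorphN1 scaleN1r. Qed.

Lemma su0 : su (0 : 'M[R[i]]_n).
Proof. by split; rewrite ?mxtrace0 // trmx0 map_mx0 oppr0. Qed.

Lemma su_conj g X : su X -> su (g *m X *m g^t*).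
Proof.
move=> [aX tX]; split; last by rewrite mxtrace_mulC mulmxA SU_adjK mul1mx.
by rewrite !trmx_mul !map_mxM trmxCK aX mulmxA mulmxN mulNmx.
Qed.

Lemma su_bracket X Y : su X -> su Y -> su (X *m Y - Y *m X).
Proof.
move=> [aX _] [aY _]; split; last by rewrite linearB /= mxtrace_mulC subrr.
by rewrite linearB /= map_mxB !trmx_mul !map_mxM aX aY !mulNmx !mulmxN !opprK opprB.
Qed.

End Su.

Section Derivative.
Variables (R : realType) (n d : nat) (r : SU R n -> 'M[R[i]]_d).
Hypothesis r1 : r 1%g = 1%:M.
Hypothesis rM : forall g h : SU R n, r (g * h)%g = r g *m r h.
Implicit Types (X Y : 'M[R[i]]_n).

(** D is the differential at 1 of r, in a form that does not refer to a
    particular curve with velocity X. *)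
Definition differential (D : 'M[R[i]]_n -> 'M[R[i]]_d) :=
  (forall X, su X -> forall g : nat -> SU R n,
     jet (fun k => SU_mx (g k)) 1%:M X -> jet (fun k => r (g k)) 1%:M (D X)) /\
  exists L : R, 0 <= L /\ forall X, su X -> mxnorm (D X) <= L * mxnorm X.

Section Existence.
Hypothesis r_cont : forall e : R, 0 < e -> exists2 dl : R, 0 < dl &
  forall g, mxnorm (SU_mx g - 1%:M) < dl -> mxnorm (r g - 1%:M) < e.

(** Along the one-parameter subgroup exp(tX) the velocity of r exists by
    jet_of_square_roots. Any other sequence g_k with velocity X differs from it by
    a factor 1 + O(4^-k), on which r is 1 + O(4^-k) by lipschitz_at1. *)
Lemma exists_differential : exists D, differential D.
Proof.
have [L [dl [L0 dl0 lip]]] := lipschitz_at1 r1 rM r_cont.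
(* The Lipschitz bound applies along a jet at 1, for large k. *)
have lip_jet (g : nat -> SU R n) X : jet (fun k => SU_mx (g k)) 1%:M X ->
    exists k0, forall k, (k0 <= k)%N ->
    mxnorm (r (g k) - 1%:M) <= L * mxnorm (SU_mx (g k) - 1%:M).
  move=> /jet_bounded[C [k0 [C0 hC]]].
  have [|k1 hk1] := eps_small (d := dl / (C + 1)).
    by rewrite divr_gt0 // ltr_wpDl.
  exists (maxn k0 k1) => k; rewrite geq_max => /andP[/hC h /hk1 hk].
  apply: lip; apply: le_lt_trans h _.
  move: hk; rewrite ltr_pdivlMr ?ltr_wpDl // => hk; apply: le_lt_trans hk.
  by rewrite mulrC ler_wpM2l ?eps_ge0 // lerDl.
suff der X : su X -> exists A : 'M[R[i]]_d, (forall g : nat -> SU R n,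
     jet (fun k => SU_mx (g k)) 1%:M X -> jet (fun k => r (g k)) 1%:M A) /\
     mxnorm A <= L * mxnorm X.
  have /choice[D hD] : forall X, exists A : 'M[R[i]]_d, su X ->
     (forall g : nat -> SU R n,
     jet (fun k => SU_mx (g k)) 1%:M X -> jet (fun k => r (g k)) 1%:M A) /\
     mxnorm A <= L * mxnorm X.
    move=> X; have [sX|nX] := pselect (su X); last by exists 0.
    by have [A hA] := der X sX; exists A.
  exists D; split=> [X sX|]; first by have [] := hD X sX.
  by exists L; split=> // X sX; have [] := hD X sX.
move=> sX; have [e [esq ej]] := exp_seq_exists sX.
have [C [k0 [C0 hC]]] := jet_bounded ej.
have [k1 hk1] := lip_jet _ _ ej.
have [A jA] : exists A, jet (fun k => r (e k)) 1%:M A.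
  apply: (@jet_of_square_roots _ _ _ (L * C) (maxn k0 k1)) => [k|k].
    by rewrite {1}esq rM.
  rewrite geq_max => /andP[/hC h /hk1]; move/le_trans; apply.
  by rewrite -mulrA ler_wpM2l.
exists A; split=> [g gj|].
  (* The correcting factor h_k has velocity - X + X = 0. *)
  pose h k := ((e k)^-1 * g k)%g.
  have hj : jet (fun k => SU_mx (h k)) 1%:M 0.
    have := jetM (jet_adj ej) gj.
    by rewrite trmx1 map_mx1 !mulmx1 mul1mx sX.1 addrC addNr.
  have rhj : jet (fun k => r (h k)) 1%:M 0.
    have [k2 hk2] := lip_jet _ _ hj; case: hj => C' [k3 hk3].
    exists (L * C'), (maxn k2 k3) => k; rewrite geq_max => /andP[/hk2 h2 /hk3 h3].
    rewrite scaler0 subr0; apply: le_trans h2 _; rewrite -mulrA ler_wpM2l //.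
    by move: h3; rewrite scaler0 subr0.
  have := jetM jA rhj; rewrite mulmx1 mul1mx mulmx1 add0r.
  by apply: jet_ext => k; rewrite -rM /h mulgA mulgV mul1g.
case: ej jA => [C1 [k2 hk2]] [C2 [k3 hk3]].
rewrite -subr_le0; apply: (@le_eps0 _ _ (C2 + L * C1) (maxn k1 (maxn k2 k3))) => k.
rewrite !geq_max => /and3P[/hk1 h1 /hk2 h2 /hk3 h3].
have e0 := eps_gt0 R k.
have a1 : eps R k * mxnorm A <= mxnorm (r (e k) - 1%:M) + C2 * eps R k ^+ 2.
  rewrite -[eps R k in leLHS]gtr0_norm // -mxnormZ.
  rewrite -[_ *: A](subKr (r (e k) - 1%:M)); apply: le_trans (mxnormB _ _) _.
  by rewrite lerD2l.
have a2 : mxnorm (SU_mx (e k) - 1%:M) <= eps R k * mxnorm X + C1 * eps R k ^+ 2.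
  rewrite -[X in mxnorm X <= _](subrK ((eps R k)%:C *: X)) addrC.
  by rewrite (le_trans (mxnormD _ _)) // mxnormZ gtr0_norm // lerD2l.
rewrite -(ler_pM2l e0) mulrBr.
have := ler_wpM2l L0 a2; move: a1 h1; rewrite expr2.
by move: (mxnorm _) (mxnorm _) (mxnorm _) (mxnorm _) => ????; lra.
Qed.

End Existence.
Variable D : 'M[R[i]]_n -> 'M[R[i]]_d.
Hypothesis hD : differential D.

Let rV g : r g *m r (g^-1)%g = 1%:M.
Proof. by rewrite -rM mulgV r1. Qed.

(** exp(tX) exp(tY) has velocity X + Y. *)
Lemma differentialD X Y : su X -> su Y -> D (X + Y) = D X + D Y.
Proof.
move=> sX sY; have [g [_ gj]] := exp_seq_exists sX.
have [h [_ hj]] := exp_seq_exists sY.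
have j1 : jet (fun k => SU_mx (g k * h k)%g) 1%:M (X + Y).
  by have := jetM gj hj; rewrite !mulmx1 mul1mx addrC.
apply: jet_uniq (hD.1 _ (suD sX sY) _ j1) _.
have := jetM (hD.1 _ sX _ gj) (hD.1 _ sY _ hj); rewrite !mulmx1 mul1mx addrC.
by apply: jet_ext => k; rewrite rM.
Qed.

Lemma differential_conj (g : SU R n) X : su X ->
  D (g *m X *m g^t*) = r g *m D X *m r (g^-1)%g.
Proof.
move=> sX; have [e [_ ej]] := exp_seq_exists sX.
have jc m (P Q A : 'M[R[i]]_m) u : P *m Q = 1%:M -> jet u 1%:M A ->
    jet (fun k => P *m u k *m Q) 1%:M (P *m A *m Q).
  move=> PQ ju; have := jetM (jetM (jet_cst P) ju) (jet_cst Q).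
  by rewrite mulmx0 mulmx1 PQ mul0mx addr0 add0r.
have gg : g *m g^t* = 1%:M by have /andP[/unitarymxP ->] := SU_mxP g.
have j1 : jet (fun k => SU_mx (g * e k * g^-1)%g) 1%:M (g *m X *m g^t*).
  exact: (jc _ _ _ _ _ gg ej).
have j2 := jc _ _ _ _ _ (rV g) (hD.1 _ sX _ ej).
apply: jet_uniq (hD.1 _ (su_conj g sX) _ j1) _.
by apply: jet_ext j2 => k; rewrite !rM.
Qed.

Lemma differentialN X : su X -> D (- X) = - D X.
Proof.
move=> sX; have D0 : D 0 = 0.
  have := differentialD (@su0 R n) (@su0 R n); rewrite addr0 => /eqP.
  by rewrite -subr_eq0 opprD addrA subrr add0r oppr_eq0 => /eqP.
apply/eqP; rewrite -addr_eq0 -differentialD ?addNr ?D0 //; exact: suN.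
Qed.

(** D is additive and bounded, hence homogeneous: the defect
    E(b) = D(bX) - b D(X) is additive in b, vanishes at 1 and is bounded on [0, 1],
    hence bounded on the positive reals, so E(b) = 2^-k E(2^k b) is arbitrarily small. *)
Lemma differentialZ (c : R) X : su X -> D (c%:C *: X) = c%:C *: D X.
Proof.
move=> sX; pose E (b : R) := D (b%:C *: X) - b%:C *: D X.
have [L [L0 hL]] := hD.2.
have ED a b : E (a + b) = E a + E b.
  rewrite /E rmorphD !scalerDl differentialD; try exact: suZ.
  by rewrite opprD addrACA.
have EN b : E (- b) = - E b.
  rewrite /E rmorphN !scaleNr differentialN; last exact: suZ.
  by rewrite opprB opprK addrC.
have E1 : E 1 = 0 by rewrite /E !scale1r subrr.
have E0 : E 0 = 0 by apply: (addrI (E 0)); rewrite -ED !addr0.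
have Enat m : E m%:R = 0.
  elim: m => [|m IH]; first by rewrite mulr0n.
  by rewrite -natr1 ED IH E1 addr0.
have EM m b : E (m%:R * b) = E b *+ m.
  elim: m => [|m IH]; first by rewrite mul0r mulr0n.
  by rewrite -natr1 mulrDl mul1r ED IH mulrSr.
pose B := L * mxnorm X + mxnorm (D X).
have EB b : 0 <= b <= 1 -> mxnorm (E b) <= B.
  move=> /andP[b0 b1]; apply: le_trans (mxnormB _ _) _; rewrite mxnormZ ger0_norm //.
  rewrite lerD //; last by rewrite ler_piMl ?mxnorm_ge0.
  apply: le_trans (hL _ (suZ b sX)) _; rewrite ler_wpM2l // mxnormZ ger0_norm //.
  by rewrite ler_piMl ?mxnorm_ge0.
have Eall b : 0 <= b -> mxnorm (E b) <= B.
  move=> b0; have -> : b = (Num.trunc b)%:R + (b - (Num.trunc b)%:R).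
    by rewrite addrC subrK.
  rewrite ED Enat add0r; apply: EB.
  have /andP[h1 h2] := truncn_itv b0.
  by rewrite subr_ge0 h1 /= lerBlDl natr1 ltW.
have Epos b : 0 <= b -> E b = 0.
  move=> b0; apply: mxnorm_eq0; apply/eqP; rewrite eq_le mxnorm_ge0 andbT.
  apply: (@le_eps0 _ _ B 0%N) => k _.
  have := Eall ((2 ^ k)%:R * b) (mulr_ge0 (ler0n _ _) b0).
  rewrite EM -scaler_nat -(rmorph_nat (real_complex R)) mxnormZ ger0_norm //.
  rewrite -(ler_pM2r (eps_gt0 R k)) mulrAC [_%:R * eps R k]mulrC eps_pow2 mul1r.
  by [].
apply/eqP; rewrite -subr_eq0; apply/eqP; rewrite -/(E c).
have [c0|/ltW c0] := leP 0 c; first exact: Epos.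
by rewrite -[c]opprK EN Epos ?oppr0 // oppr_ge0.
Qed.

Lemma jet_differential (w : nat -> 'M[R[i]]_n) P X :
  (forall k, su (w k)) -> su P -> su X -> jet w P X ->
  jet (fun k => D (w k)) (D P) (D X).
Proof.
move=> sw sP sX [C [k0 h]]; have [L [L0 hL]] := hD.2.
exists (L * C), k0 => k /h {}h.
rewrite -differentialZ // -!differentialN; try exact: suZ; try by [].
have s1 : su (w k - P) by apply: suD => //; apply: suN.
have s2 : su (- ((eps R k)%:C *: X)) by apply/suN/suZ.
rewrite -!differentialD //; last exact: suN.
by rewrite (le_trans (hL _ (suD s1 s2))) // -mulrA ler_wpM2l.
Qed.

(** Take the velocity of both sides of
    D(g Y g^-1) r(g) = r(g) D(Y) along g = exp(tX). *)
Lemma differential_bracket X Y : su X -> su Y ->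
  D (X *m Y - Y *m X) = D X *m D Y - D Y *m D X.
Proof.
move=> sX sY; have [g [_ gj]] := exp_seq_exists sX.
pose w k := g k *m Y *m (g k)^t*.
have wj : jet w Y (X *m Y - Y *m X).
  have := jetM (jetM gj (jet_cst Y)) (jet_adj gj).
  by rewrite trmx1 map_mx1 !mulmx1 !mul1mx add0r sX.1 mulmxN addrC.
have jDw := jet_differential (fun k => su_conj (g k) sY) sY (su_bracket sX sY) wj.
have jr := hD.1 _ sX _ gj.
have j1 := jetM jDw jr; have j2 := jetM jr (jet_cst (D Y)).
have e k : D (w k) *m r (g k) = r (g k) *m D Y.
  by rewrite /w differential_conj // -mulmxA -rM mulVg r1 mulmx1.
have := jet_uniq (jet_ext e j1); rewrite mulmx1.
rewrite mul1mx mulmx0 add0r in j2; rewrite mulmx1.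
move=> /(_ _ j2); rewrite addrC => <-.
by rewrite addrK.
Qed.

End Derivative.

(** * Recovering a representation from its differential *)

Section Powers.
Variables (R : realType) (d : nat).
Implicit Types u v : 'M[R[i]]_d.

Definition mxpow u k := iter k (mulmx u) 1%:M.

Lemma mxpowSr u k : mxpow u k.+1 = mxpow u k *m u.
Proof.
elim: k => [|k IH]; first by rewrite /= mulmx1 mul1mx.
by rewrite /= -mulmxA; congr (_ *m _).
Qed.

Lemma mxnorm_mxpow_sub1 u k : mxnorm (mxpow u k - 1%:M) <= (1 + mxnorm (u - 1%:M)) ^+ k - 1.
Proof.
set x := mxnorm (u - 1%:M); have x0 : 0 <= x by apply: mxnorm_ge0.
elim: k => [|k IH]; first by rewrite expr0 !subrr mxnorm0.
have -> : mxpow u k.+1 - 1%:M =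
    (u - 1%:M) *m (mxpow u k - 1%:M) + ((mxpow u k - 1%:M) + (u - 1%:M)).
  by rewrite mulmxBl mul1mx mulmxBr mulmx1 /=; apply/matrixP => i j; rewrite !mxE; ring.
apply: le_trans (mxnormD _ _) _; rewrite exprS.
apply: le_trans (_ : x * mxnorm (mxpow u k - 1%:M) + (mxnorm (mxpow u k - 1%:M) + x) <= _).
  by rewrite lerD ?mxnormM ?mxnormD.
by have := ler_wpM2l x0 IH; move: IH; lra.
Qed.

Lemma mxnorm_mxpow_le u k (C : R) j : mxnorm (u - 1%:M) <= C * eps R k -> (j <= 2 ^ k)%N ->
  mxnorm (mxpow u j) <= mxnorm (1%:M : 'M[R[i]]_d) + expR C.
Proof.
move=> uC jk; rewrite -[mxpow u j](subrK 1%:M) addrC.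
apply: le_trans (mxnormD _ _) _; rewrite lerD2l.
apply: le_trans (mxnorm_mxpow_sub1 u j) _.
have x0 := mxnorm_ge0 (u - 1%:M).
apply: le_trans (_ : (1 + mxnorm (u - 1%:M)) ^+ j <= _); first by rewrite lerBlDl lerDr.
apply: le_trans (_ : (1 + mxnorm (u - 1%:M)) ^+ (2 ^ k) <= _).
  by rewrite ler_weXn2l // lerDl.
apply: le_trans (_ : expR (C * eps R k) ^+ (2 ^ k) <= _).
  rewrite ler_pXn2r ?nnegrE ?expR_ge0 ?addr_ge0 //; last by rewrite expn_gt0.
  by apply: le_trans (expR_ge1Dx _); rewrite lerD2l.
by rewrite -expRM_natr -mulrA eps_pow2 mulr1.
Qed.

(** Telescoping: u^m - v^m is the sum of the v^a (u - v) u^(m-1-a), whose outer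
    factors stay bounded because (1 + C/m)^m <= exp(C). *)
Lemma mxnorm_mxpowB u v k (C e : R) :
  mxnorm (u - 1%:M) <= C * eps R k -> mxnorm (v - 1%:M) <= C * eps R k ->
  mxnorm (u - v) <= e ->
  mxnorm (mxpow u (2 ^ k) - mxpow v (2 ^ k))
    <= (2 ^ k)%:R * ((mxnorm (1%:M : 'M[R[i]]_d) + expR C) ^+ 2 * e).
Proof.
move=> uC vC uv; set K := mxnorm 1%:M + expR C.
have K0 : 0 <= K by rewrite addr_ge0 ?mxnorm_ge0 ?expR_ge0.
have e0 : 0 <= e by apply: le_trans (mxnorm_ge0 _) uv.
(* Carrying the prefix v^a along the induction avoids multiplying norms of v. *)
have main j a : (a + j <= 2 ^ k)%N ->
    mxnorm (mxpow v a *m (mxpow u j - mxpow v j)) <= j%:R * (K ^+ 2 * e).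
  elim: j a => [|j IH] a aj; first by rewrite subrr mulmx0 mxnorm0 mul0r.
  have -> : mxpow v a *m (mxpow u j.+1 - mxpow v j.+1) =
      mxpow v a *m (u - v) *m mxpow u j + mxpow v a.+1 *m (mxpow u j - mxpow v j).
    rewrite (mxpowSr v a) /= !mulmxBr mulmxBl -!mulmxA.
    by rewrite addrA subrK.
  rewrite (le_trans (mxnormD _ _)) // -natr1 mulrDl mul1r addrC lerD //.
    by apply: IH; rewrite addSnnS.
  apply: le_trans (mxnormM _ _) _; rewrite expr2 mulrAC.
  rewrite ler_pM ?mxnorm_ge0 //; last first.
    by apply: mxnorm_mxpow_le uC _; rewrite (leq_trans _ aj) // addnS ltnW // ltnS leq_addl.
  apply: le_trans (mxnormM _ _) _; rewrite ler_pM ?mxnorm_ge0 //.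
  by apply: mxnorm_mxpow_le vC _; rewrite (leq_trans _ aj) // leq_addr.
by have := main (2 ^ k)%N 0%N (leqnn _); rewrite mul1mx.
Qed.

End Powers.

Section Exponential.
Variables (R : realType) (n d : nat) (r : SU R n -> 'M[R[i]]_d).
Hypothesis r1 : r 1%g = 1%:M.
Hypothesis rM : forall g h : SU R n, r (g * h)%g = r g *m r h.

Lemma rep_expg (g : SU R n) k : r (g ^+ k)%g = mxpow (r g) k.
Proof. by elim: k => [|k IH]; rewrite ?expg0 ?r1 // expgS rM IH. Qed.

Lemma exp_seq_pow (e : nat -> SU R n) X k : exp_seq e X -> e 0%N = (e k ^+ (2 ^ k))%g.
Proof.
move=> [esq _]; elim: k => [|k ->]; first by rewrite expg1.
by rewrite [in LHS]esq -expg2 -expgnA expnS.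
Qed.

(** Euler's formula r(exp X) = lim (1 + D(X)/m)^m along m = 2^k. *)
Lemma rep_approx (e : nat -> SU R n) X A : exp_seq e X -> jet (fun k => r (e k)) 1%:M A ->
  exists C k0, forall k, (k0 <= k)%N ->
    mxnorm (r (e 0%N) - mxpow (1%:M + (eps R k)%:C *: A) (2 ^ k)) <= C * eps R k.
Proof.
move=> es ej; have [C1 [k1 [C10 h1]]] := jet_bounded ej.
have [C2 [k2 [C20 h2]]] := jet_bounded (jet_affine 1%:M A).
have [C3 [k3 h3]] := ej.
set K := mxnorm (1%:M : 'M[R[i]]_d) + expR (C1 + C2).
exists (K ^+ 2 * C3), (maxn k1 (maxn k2 k3)) => k.
rewrite !geq_max => /and3P[/h1 {}h1 /h2 {}h2 /h3 {}h3].
rewrite (exp_seq_pow k es) rep_expg.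
have e0 := eps_ge0 R k.
apply: le_trans (mxnorm_mxpowB (C := C1 + C2) (e := C3 * eps R k ^+ 2) _ _ _) _.
- by apply: le_trans h1 _; rewrite ler_wpM2r // lerDl.
- by apply: le_trans h2 _; rewrite ler_wpM2r // lerDr.
- by rewrite opprD addrA.
rewrite -/K expr2 !mulrA; rewrite mulrC !mulrA eps_pow2 mul1r.
by rewrite le_eqVlt; apply/orP; left; apply/eqP; ring.
Qed.

End Exponential.

Lemma mxpow_intertwine (R : realType) d d' (P : 'M[R[i]]_(d', d))
    (u : 'M[R[i]]_d) (v : 'M[R[i]]_d') k :
  P *m u = v *m P -> P *m mxpow u k = mxpow v k *m P.
Proof.
move=> uv; elim: k => [|k IH]; first by rewrite mulmx1 mul1mx.
by rewrite /= mulmxA uv -mulmxA IH mulmxA.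
Qed.

(** * Matrix coordinates and continuity *)

Section Topology.
Variables (R : realType) (n : nat).

Lemma norm_le_cnorm (z : R[i]) : `|z| <= (cnorm z)%:C.
Proof.
case: z => a b; rewrite normc_def /= lecR /cnorm /=.
rewrite -[leRHS]ger0_norm ?addr_ge0 // -sqrtr_sqr ler_wsqrtr //.
rewrite sqrrD !real_normK ?num_real // -addrA lerD2l lerDr.
by rewrite mulrn_wge0 // mulr_ge0.
Qed.

Lemma cnorm_lt_of_norm (z : R[i]) (e : R) : `|z| < e%:C -> cnorm z < 2 * e.
Proof.
case: z => a b; rewrite normc_def /= ltcR /cnorm /= => h.
have ha : `|a| < e.
  apply: le_lt_trans h; rewrite -sqrtr_sqr ler_wsqrtr //.
  by rewrite lerDl sqr_ge0.
have hb : `|b| < e.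
  apply: le_lt_trans h; rewrite -sqrtr_sqr ler_wsqrtr //.
  by rewrite lerDr sqr_ge0.
by lra.
Qed.

Lemma nbhs_mxnorm (A : 'M[R[i]]_n) (U : set 'M[R[i]]_n) : nbhs A U ->
  exists2 e : R, 0 < e & forall B : 'M[R[i]]_n, mxnorm (B - A) < e -> U B.
Proof.
move=> /nbhs_ballP[[e e'] /= e0 h].
move: e0; rewrite ltcE /= => /andP[/eqP e'0 e0]; exists e => // B hB.
apply: h; split=> [|i j]; first by rewrite ltcE /= e'0 eqxx e0.
  rewrite /ball /= distrC; apply: le_lt_trans (norm_le_cnorm _) _.
rewrite e'0 -[e +i* 0]/(e%:C) ltcR; apply: le_lt_trans hB.
by have := cnorm_le_mxnorm (B - A) i j; rewrite !mxE.
Qed.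

Lemma continuous_SU_at1 (f : SU R n -> R[i]) : continuous f -> forall e : R, 0 < e ->
  exists2 dl : R, 0 < dl &
    forall g : SU R n, mxnorm (SU_mx g - 1%:M) < dl -> cnorm (f g - f 1%g) < e.
Proof.
move=> /(_ 1%g) fc e e0.
have : nbhs (f 1%g) (ball (f 1%g) ((e / 2)%:C)).
  by apply: nbhsx_ballx; rewrite ltcR divr_gt0.
move=> /fc /=; rewrite /nbhs /= => -[_ [[U oU <-] /= U1] sub].
have [dl dl0 hdl] : exists2 dl : R, 0 < dl &
    forall B : 'M[R[i]]_n, mxnorm (B - 1%:M) < dl -> U B.
  by apply: nbhs_mxnorm; apply: open_nbhs_nbhs.
exists dl => // g hg; have := sub g (hdl _ hg).
rewrite /ball /= distrC => /cnorm_lt_of_norm.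
by rewrite mulrCA divff ?mulr1.
Qed.

End Topology.

Section Coordinates.
Variables (K : fieldType) (V : vectType K).
Local Notation d := (\dim (fullv : {vspace V})).
Local Notation b := (vbasis (fullv : {vspace V})).

(** Locked: only the linear bijection with column vectors matters, not the basis. *)
Definition coords : V -> 'cV[K]_d := locked (fun x : V => \col_j coord b j x).
Definition of_coords : 'cV[K]_d -> V := locked (fun c : 'cV[K]_d => \sum_j c j 0 *: b`_j).

Lemma coordsE x j : coords x j 0 = coord b j x.
Proof. by rewrite /coords -lock mxE. Qed.

Lemma of_coordsE (c : 'cV[K]_d) : of_coords c = \sum_j c j 0 *: b`_j.
Proof. by rewrite /of_coords -lock. Qed.

Lemma coordsK : cancel coords of_coords.
Proof.
move=> x; rewrite of_coordsE {2}(coord_vbasis (memvf x)).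
by apply: eq_bigr => j _; rewrite coordsE.
Qed.

Lemma of_coordsK : cancel of_coords coords.
Proof.
move=> c; apply/colP => j; rewrite coordsE of_coordsE coord_sum_free //.
exact: basis_free (vbasisP _).
Qed.

Lemma coords_linear a x y : coords (a *: x + y) = a *: coords x + coords y.
Proof. by apply/colP => j; rewrite !(mxE, coordsE) linearP. Qed.

Lemma of_coords_linear a x y : of_coords (a *: x + y) = a *: of_coords x + of_coords y.
Proof. by apply: (can_inj coordsK); rewrite coords_linear !of_coordsK. Qed.

Lemma coordsB x y : coords (x - y) = coords x - coords y.
Proof. by apply/colP => j; rewrite !(mxE, coordsE) linearB. Qed.

Lemma coords0 : coords 0 = 0.
Proof. by apply/colP => j; rewrite !(mxE, coordsE) linear0. Qed.

Definition mx_of p (f : V -> 'cV[K]_p) : 'M[K]_(p, d) := \matrix_(i, j) f b`_j i 0.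

Lemma mx_ofE p (f : V -> 'cV[K]_p) x : linear f -> mx_of f *m coords x = f x.
Proof.
move=> lf; pose f' := GRing.isLinear.Build _ _ _ _ f lf.
pose F : {linear V -> 'cV[K]_p} := HB.pack f f'.
apply/colP => i; rewrite mxE [in RHS](coord_vbasis (memvf x)).
rewrite -[f _]/(F _) linear_sum summxE; apply: eq_bigr => j _.
by rewrite linearZ /= !mxE coordsE mulrC.
Qed.

Definition endo_mx (f : V -> V) : 'M[K]_d := mx_of (fun x => coords (f x)).

Lemma endo_mxE (f : V -> V) x : linear f -> endo_mx f *m coords x = coords (f x).
Proof. by move=> lf; apply: mx_ofE => a y z; rewrite lf coords_linear. Qed.

Lemma mx_coords_inj p (A B : 'M[K]_(p, d)) :
  (forall x, A *m coords x = B *m coords x) -> A = B.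
Proof.
move=> h; apply/trmx_inj/row_matrixP => j; rewrite -!tr_col; congr trmx.
by rewrite !colE -(of_coordsK (delta_mx j 0)) h.
Qed.

End Coordinates.

Section RepMatrix.
Variables (R : realType) (n : nat) (V : vectType R[i]) (rho : representation (SU R n) V).
Hypothesis rho_cont : continuous_rep rho.

Definition rep_mx (g : SU R n) := endo_mx (rho g).

Lemma rep_mxE g x : rep_mx g *m coords x = coords (rho g x).
Proof. exact: endo_mxE (act_linear rho g). Qed.

Lemma rep_mx1 : rep_mx 1%g = 1%:M.
Proof. by apply: mx_coords_inj => x; rewrite rep_mxE act1 mul1mx. Qed.

Lemma rep_mxM (g h : SU R n) : rep_mx (g * h)%g = rep_mx g *m rep_mx h.
Proof. by apply: mx_coords_inj => x; rewrite -mulmxA !rep_mxE actM. Qed.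

(** There are finitely many coefficients, so the smallest of their radii works. *)
Lemma rep_mx_continuous (e : R) : 0 < e -> exists2 dl : R, 0 < dl &
  forall g, mxnorm (SU_mx g - 1%:M) < dl -> mxnorm (rep_mx g - 1%:M) < e.
Proof.
move=> e0; set d := \dim (fullv : {vspace V}).
pose e' := e / ((d * d)%:R + 1).
have e'0 : 0 < e' by rewrite divr_gt0 // ltr_wpDl.
have ent : forall p : 'I_d * 'I_d, exists dl : R, 0 < dl /\
    forall g, mxnorm (SU_mx g - 1%:M) < dl ->
      cnorm (rep_mx g p.1 p.2 - rep_mx 1%g p.1 p.2) < e'.
  move=> [i j]; have := continuous_SU_at1 (@rho_cont (vbasis fullv)`_j i) e'0.
  by move=> [dl dl0 h]; exists dl; split=> // g /h; rewrite !mxE !coordsE.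
have [dl hdl] := choice ent.
exists (\big[Num.min/1]_p dl p).
  elim/big_ind: _ => // [x y x0 y0|p _]; first by rewrite lt_min x0.
  by have [] := hdl p.
move=> g hg; rewrite -rep_mx1.
have le i j : cnorm ((rep_mx g - rep_mx 1%g) i j) <= e'.
  have [_ h] := hdl (i, j); have := h g; rewrite /= !mxE; move/(_ _)/ltW; apply.
  by apply: lt_le_trans hg _; apply: bigmin_le_cond.
apply: le_lt_trans (_ : \sum_(i < d) \sum_(j < d) e' < _).
  by apply: ler_sum => i _; apply: ler_sum => j _; apply: le.
rewrite !sumr_const !card_ord -mulrnA -mulr_natr /e' mulrAC ltr_pdivrMr ?ltr_wpDl //.
by rewrite ltr_pM2l // ltrDl.
Qed.

End RepMatrix.

(** * Complexifying the differential *)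

Section SkewPart.
Variables (R : realType) (n : nat).
Hypothesis n_gt0 : (0 < n)%N.
Implicit Types (A B X : 'M[R[i]]_n).

Definition iC : R[i] := 0 +i* 1.

Lemma iCM : iC * iC = -1.
Proof. by apply/eqP; rewrite eq_complex /=; apply/andP; split; apply/eqP; ring. Qed.

Lemma conj_iC : (iC^*)%R = - iC.
Proof. by apply/eqP; rewrite eq_complex /=; apply/andP; split; apply/eqP; ring. Qed.

Lemma complex_split (z : R[i]) : z = (complex.Re z)%:C + iC * (complex.Im z)%:C.
Proof.
case: z => a b; apply/eqP; rewrite eq_complex /=; apply/andP; split; apply/eqP; ring.
Qed.

Definition traceless A := A - (\tr A / n%:R)%:M.

(** With iC times a second skew-Hermitian matrix, this recovers the traceless
    part of A: sl_n(C) is the complexification of su_n. *)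
Definition skew_part :=
  locked (fun A => ((2^-1 : R)%:C) *: (traceless A - (traceless A)^t*)).

Lemma skew_partE A :
  skew_part A = ((2^-1 : R)%:C) *: (traceless A - (traceless A)^t*).
Proof. by rewrite /skew_part -lock. Qed.

Lemma tr_traceless A : \tr (traceless A) = 0.
Proof.
rewrite /traceless linearB /= mxtrace_scalar -[X in _ - X]mulr_natr divfK ?subrr //.
by rewrite pnatr_eq0 -lt0n.
Qed.

Lemma adj_tr A : \tr (A^t*) = ((\tr A)^*)%R.
Proof.
by rewrite -[in RHS]mxtrace_tr /mxtrace rmorph_sum; apply: eq_bigr => j _; rewrite !mxE.
Qed.

Lemma skew_part_su A : su (skew_part A).
Proof.
rewrite skew_partE; apply: suZ; split; last first.
  by rewrite linearB /= adj_tr tr_traceless rmorph0 subrr.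
by move: (traceless A) => T; rewrite linearB /= map_mxB trmxCK opprB.
Qed.

Lemma tracelessD A B : traceless (A + B) = traceless A + traceless B.
Proof. by rewrite /traceless linearD /= mulrDl raddfD /= opprD addrACA. Qed.

Lemma tracelessZ (a : R[i]) A : traceless (a *: A) = a *: traceless A.
Proof. by rewrite /traceless linearZ /= -mulrA -scale_scalar_mx scalerBr. Qed.

Lemma adjD A B : (A + B)^t* = A^t* + B^t*.
Proof. by rewrite linearD /= map_mxD. Qed.

Lemma adjZ (a : R[i]) A : (a *: A)^t* = (a^*)%R *: A^t*.
Proof. by rewrite linearZ /= map_mxZ. Qed.

Lemma skew_partD A B : skew_part (A + B) = skew_part A + skew_part B.
Proof. by rewrite !skew_partE tracelessD adjD opprD addrACA scalerDr. Qed.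

Lemma skew_partZ (c : R) A : skew_part (c%:C *: A) = c%:C *: skew_part A.
Proof.
rewrite !skew_partE tracelessZ adjZ (_ : (c%:C^*)%R = c%:C); last exact: conjc_real.
by rewrite -scalerBr !scalerA mulrC.
Qed.

Lemma skew_partN A : skew_part (- A) = - skew_part A.
Proof. by have := skew_partZ (-1) A; rewrite rmorphN1 !scaleN1r. Qed.

Lemma traceless_su X : su X -> traceless X = X.
Proof. by move=> [_ tX]; rewrite /traceless tX mul0r raddf0 subr0. Qed.

Lemma half_double (A : 'M[R[i]]_n) : ((2^-1 : R)%:C) *: (A + A) = A.
Proof.
have -> : A + A = (2 : R)%:C *: A by rewrite rmorph_nat scaler_nat mulr2n.
rewrite scalerA -rmorphM /=.
by rewrite mulVf ?scale1r.
Qed.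

Lemma skew_part_id X : su X -> skew_part X = X.
Proof. by move=> sX; rewrite !skew_partE traceless_su // sX.1 opprK half_double. Qed.

Lemma skew_part_iC X : su X -> skew_part (iC *: X) = 0.
Proof.
move=> sX; rewrite !skew_partE tracelessZ traceless_su // adjZ conj_iC sX.1.
by rewrite scaleNr scalerN opprK subrr scaler0.
Qed.

Lemma skew_part_scalar (z : R[i]) : skew_part z%:M = 0.
Proof.
rewrite !skew_partE; have -> : traceless (z%:M : 'M[R[i]]_n) = 0.
  rewrite /traceless mxtrace_scalar -[X in X / _]mulr_natr mulfK ?subrr //.
  by rewrite pnatr_eq0 -lt0n.
by rewrite trmx0 map_mx0 subrr scaler0.
Qed.

Lemma skew_decomposition A :
  A = skew_part A + iC *: skew_part (- (iC *: A)) + (\tr A / n%:R)%:M.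
Proof.
have -> : skew_part A + iC *: skew_part (- (iC *: A)) = traceless A.
  have cN : ((- iC)^*)%R = iC.
    by apply/eqP; rewrite eq_complex /=; apply/andP; split; apply/eqP; ring.
  rewrite !skew_partE -scaleNr tracelessZ adjZ cN; move: (traceless A) => T.
  rewrite scalerA [iC * _]mulrC -scalerA -scalerDr scalerBr !scalerA mulrN iCM.
  by rewrite opprK scale1r scaleN1r opprK addrACA addNr addr0 half_double.
by rewrite /traceless subrK.
Qed.

Lemma skew_part_conj (g : SU R n) A :
  skew_part (g *m A *m g^t*) = g *m skew_part A *m g^t*.
Proof.
have gg : g *m g^t* = 1%:M by have /andP[/unitarymxP ->] := SU_mxP g.
have tl : traceless (g *m A *m g^t*) = g *m traceless A *m g^t*.
  rewrite /traceless mxtrace_mulC mulmxA SU_adjK mul1mx mulmxBr mulmxBl.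
  by rewrite mul_mx_scalar -scalemxAl gg scalemx1.
rewrite !skew_partE tl; move: (traceless A) => T.
rewrite !trmx_mul !map_mxM trmxCK -scalemxAr -scalemxAl mulmxBr mulmxBl.
by congr (_ *: (_ - _)); rewrite mulmxA.
Qed.

End SkewPart.

Section Complexify.
Variables (R : realType) (n d : nat) (r : SU R n -> 'M[R[i]]_d).
Hypothesis n_gt0 : (0 < n)%N.
Hypothesis r1 : r 1%g = 1%:M.
Hypothesis rM : forall g h : SU R n, r (g * h)%g = r g *m r h.
Variable D : 'M[R[i]]_n -> 'M[R[i]]_d.
Hypothesis hD : differential r D.
Implicit Types (A B X : 'M[R[i]]_n).
Local Notation J := (iC R).
Local Notation sk := (@skew_part R n).

(** The complex-linear extension of D, extended by zero to scalar matrices. *)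
Definition cdiff := locked (fun A => D (sk A) + J *: D (sk (- (J *: A)))).

Lemma cdiffE A : cdiff A = D (sk A) + J *: D (sk (- (J *: A))).
Proof. by rewrite /cdiff -lock. Qed.

Let skS A : su (sk A). Proof. exact: skew_part_su. Qed.

Lemma cdiffD A B : cdiff (A + B) = cdiff A + cdiff B.
Proof.
rewrite !cdiffE [J *: (A + B)]scalerDr [- (_ + _)]opprD.
rewrite (skew_partD A B) (skew_partD (- (J *: A)) (- (J *: B))).
transitivity (D (sk A) + D (sk B) + J *: (D (sk (- (J *: A))) + D (sk (- (J *: B))))).
  by congr (_ + _ *: _); apply: (differentialD rM hD); apply: skS.
by rewrite [J *: (_ + _)]scalerDr addrACA.
Qed.

Lemma cdiffZr (c : R) A : cdiff (c%:C *: A) = c%:C *: cdiff A.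
Proof.
have -> : cdiff (c%:C *: A) = D (sk (c%:C *: A)) + J *: D (sk (c%:C *: - (J *: A))).
  by rewrite !cdiffE scalerN !scalerA mulrC.
rewrite (skew_partZ c A) (skew_partZ c (- (J *: A))).
transitivity (c%:C *: D (sk A) + J *: (c%:C *: D (sk (- (J *: A))))).
  by congr (_ + _ *: _); apply: (differentialZ rM hD); apply: skS.
rewrite !cdiffE [RHS]scalerDr.
by rewrite !scalerA mulrC.
Qed.

Lemma cdiffN A : cdiff (- A) = - cdiff A.
Proof. by have := cdiffZr (-1) A; rewrite rmorphN1 !scaleN1r. Qed.

Lemma cdiffJ A : cdiff (J *: A) = J *: cdiff A.
Proof.
rewrite !cdiffE scalerA iCM scaleN1r opprK addrC scalerDr scalerA iCM scaleN1r.
by rewrite skew_partN (differentialN rM hD (skS _)) opprK.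
Qed.

Lemma cdiffZ (z : R[i]) A : cdiff (z *: A) = z *: cdiff A.
Proof.
rewrite (complex_split z) !scalerDl cdiffD cdiffZr -!scalerA cdiffJ cdiffZr.
by [].
Qed.

Lemma differential0 : D 0 = 0.
Proof.
have := differentialD rM hD (su0 R n) (su0 R n); rewrite addr0 => /eqP.
by rewrite -subr_eq0 opprD addrA subrr add0r oppr_eq0 => /eqP.
Qed.

Lemma cdiff_su X : su X -> cdiff X = D X.
Proof.
move=> sX; rewrite !cdiffE skew_part_id // skew_partN skew_part_iC // oppr0.
by rewrite differential0 scaler0 addr0.
Qed.

Lemma cdiff_scalar z : cdiff z%:M = 0.
Proof.
rewrite !cdiffE scale_scalar_mx skew_partN !skew_part_scalar // oppr0.
by rewrite differential0 scaler0 addr0.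
Qed.

Lemma commutator_expand m (X Y X' Y' : 'M[R[i]]_m) (z z' : R[i]) :
  (X + J *: Y + z%:M) *m (X' + J *: Y' + z'%:M)
    - (X' + J *: Y' + z'%:M) *m (X + J *: Y + z%:M) =
  (X *m X' - X' *m X) + J *: (X *m Y' - Y' *m X) + J *: (Y *m X' - X' *m Y)
    - (Y *m Y' - Y' *m Y).
Proof.
have JJ (T : 'M[R[i]]_m) : J *: (J *: T) = - T by rewrite scalerA iCM scaleN1r.
rewrite !mulmxDl !mulmxDr !mul_scalar_mx !mul_mx_scalar -!scalemxAl -!scalemxAr !JJ.
apply/matrixP => i j; rewrite !mxE; ring.
Qed.

(** Both sides are complex bilinear and vanish on scalars, so it suffices to
    compare them on su_n. *)
Lemma cdiff_bracket A B :
  cdiff (A *m B - B *m A) = cdiff A *m cdiff B - cdiff B *m cdiff A.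
Proof.
have base X Y : su X -> su Y ->
    cdiff (X *m Y - Y *m X) = cdiff X *m cdiff Y - cdiff Y *m cdiff X.
  move=> sX sY; rewrite !cdiff_su //; last exact: su_bracket.
  exact: (differential_bracket r1 rM hD sX sY).
have dec C : exists X Y z, [/\ su X, su Y, C = X + J *: Y + z%:M
    & cdiff C = cdiff X + J *: cdiff Y + 0%:M].
  exists (sk C), (sk (- (J *: C))), (\tr C / n%:R); split=> //.
    exact: skew_decomposition.
  rewrite {1}(skew_decomposition C) cdiffD cdiffD cdiff_scalar cdiffJ.
  by rewrite raddf0.
have [X [Y [z [sX sY defA ->]]]] := dec A.
have [X' [Y' [z' [sX' sY' defB ->]]]] := dec B.
rewrite {}defA {}defB !commutator_expand.
rewrite cdiffD cdiffN cdiffD cdiffD !cdiffJ.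
rewrite (base _ _ sX sX') (base _ _ sX sY') (base _ _ sY sX') (base _ _ sY sY').
by [].
Qed.

Lemma cdiff_conj (g : SU R n) A : cdiff (g *m A *m g^t*) = r g *m cdiff A *m r (g^-1)%g.
Proof.
have e : - (J *: (g *m A *m g^t*)) = g *m (- (J *: A)) *m g^t*.
  by rewrite mulmxN mulNmx -scalemxAr -scalemxAl.
rewrite !cdiffE e (skew_part_conj g A) (skew_part_conj g (- (J *: A))).
transitivity (r g *m D (sk A) *m r (g^-1)%g
   + J *: (r g *m D (sk (- (J *: A))) *m r (g^-1)%g)).
  by congr (_ + _ *: _); apply: (differential_conj r1 rM hD); apply: skS.
by rewrite mulmxDr mulmxDl -scalemxAr -scalemxAl.
Qed.

End Complexify.

(** * The Lie action attached to a representation of SU_n *)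

Section LieActionOfRep.
Variables (R : realType) (n : nat) (V : vectType R[i]) (rho : representation (SU R n) V).
Hypothesis n_gt0 : (0 < n)%N.
Local Notation d := (\dim (fullv : {vspace V})).
Local Notation r := (rep_mx rho).
Local Notation J := (iC R).
Local Notation r1 := (rep_mx1 rho).
Local Notation rM := (rep_mxM rho).
Variable D : 'M[R[i]]_n -> 'M[R[i]]_d.
Hypothesis hD : differential r D.

Definition lie_fun A x := of_coords (cdiff D A *m coords x).

Lemma coords_lie_fun A x : coords (lie_fun A x) = cdiff D A *m coords x.
Proof. exact: of_coordsK. Qed.

Lemma lie_funDl a A B x : lie_fun (a *: A + B) x = a *: lie_fun A x + lie_fun B x.
Proof.
rewrite /lie_fun -of_coords_linear (cdiffD n_gt0 rM hD) (cdiffZ n_gt0 rM hD).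
by rewrite mulmxDl scalemxAl.
Qed.

Lemma lie_funDr A a x y : lie_fun A (a *: x + y) = a *: lie_fun A x + lie_fun A y.
Proof. by rewrite /lie_fun -of_coords_linear coords_linear mulmxDr scalemxAr. Qed.

Lemma lie_funB A B x :
  lie_fun (A *m B - B *m A) x = lie_fun A (lie_fun B x) - lie_fun B (lie_fun A x).
Proof.
apply: (can_inj (@coordsK _ V)); rewrite coordsB !coords_lie_fun.
by rewrite (cdiff_bracket n_gt0 r1 rM hD) mulmxBl -!mulmxA.
Qed.

Definition lie_of_rep : lie_action n V := LieAction lie_funDl lie_funDr lie_funB.
Local Notation e := lie_of_rep.

Lemma coords_lie A x : coords (e A x) = cdiff D A *m coords x.
Proof. exact: coords_lie_fun. Qed.

Lemma lie_scalar z x : e z%:M x = 0.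
Proof.
apply: (can_inj (@coordsK _ V)).
by rewrite coords_lie (cdiff_scalar n_gt0 rM hD) mul0mx coords0.
Qed.

Lemma lie_conj (g : SU R n) A x : e (g *m A *m g^t*) (rho g x) = rho g (e A x).
Proof.
apply: (can_inj (@coordsK _ V)).
rewrite coords_lie (cdiff_conj n_gt0 r1 rM hD) -!rep_mxE coords_lie.
by rewrite -!mulmxA (mulmxA (r _) (r g)) -rep_mxM mulVg rep_mx1 mul1mx.
Qed.

(** Linear identities satisfied by the approximations (1 + 2^-k D(X))^(2^k) pass
    to r(exp X). *)
Lemma rep_limit p q (N : 'M[R[i]]_(p, d)) (c : 'M[R[i]]_(d, q)) T (s : nat -> SU R n) X :
  su X -> exp_seq s X ->
  (forall k, N *m mxpow (1%:M + (eps R k)%:C *: D X) (2 ^ k) *m c = T) ->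
  N *m r (s 0%N) *m c = T.
Proof.
move=> sX hs hT; have [C [k0 h]] := rep_approx r1 rM hs (hD.1 _ sX _ hs.2).
apply/eqP; rewrite -subr_eq0; apply/eqP/mxnorm_eq0/eqP; rewrite eq_le mxnorm_ge0 andbT.
apply: (@le_eps0 _ _ (mxnorm N * C * mxnorm c) k0) => k /h {}h.
rewrite -(hT k) -mulmxBl -mulmxBr; apply: le_trans (mxnormM _ _) _.
rewrite mulrAC ler_wpM2r ?mxnorm_ge0 //; apply: le_trans (mxnormM _ _) _.
by rewrite -mulrA ler_wpM2l ?mxnorm_ge0.
Qed.

Lemma mxpow_lie (P : V -> Prop) X (t : R[i]) x k : su X ->
  (forall y, P y -> P (t *: e X y + y)) -> P x ->
  exists2 y, P y & mxpow (1%:M + t *: D X) k *m coords x = coords y.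
Proof.
move=> sX Pe Px; elim: k => [|k [y Py IH]]; first by exists x; rewrite ?mul1mx.
exists (t *: e X y + y); first exact: Pe.
rewrite /= -mulmxA IH coords_linear coords_lie (cdiff_su rM hD) // mulmxDl mul1mx.
by rewrite -scalemxAl addrC.
Qed.

(** Apply rep_limit to the matrix of the projection along U, whose kernel is U. *)
Lemma stable_of_lie_stable (U : {vspace V}) : (forall A x, x \in U -> e A x \in U) ->
  forall g x, x \in U -> rho g x \in U.
Proof.
move=> stabU g x xU; have [X [s [sX hs <-]]] := exp_seq_onto g n_gt0.
pose f y := y - projv U y.
have lf : linear f by move=> a y z; rewrite /f linearP scalerBr opprD addrACA.
have f0 y : y \in U -> f y = 0 by move=> yU; rewrite /f projv_id ?subrr.
have h : endo_mx f *m r (s 0%N) *m coords x = 0.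
  apply: (rep_limit sX hs) => k.
  have [|y yU e'] := @mxpow_lie (fun y => y \in U) X (eps R k)%:C x (2 ^ k) sX _ xU.
  - by move=> y yU; rewrite memvD ?memvZ ?stabU.
  - by rewrite -mulmxA e' endo_mxE // f0 // coords0.
rewrite -mulmxA rep_mxE endo_mxE // -(coords0 V) in h; move/(can_inj (@coordsK _ V)): h => /eqP.
by rewrite subr_eq0 => /eqP ->; apply: memv_proj.
Qed.

Lemma fixed_of_lie_killed x : (forall A, e A x = 0) -> forall g, rho g x = x.
Proof.
move=> ex0 g; have [X [s [sX hs <-]]] := exp_seq_onto g n_gt0.
apply: (can_inj (@coordsK _ V)); rewrite -rep_mxE -[r _]mul1mx; apply: (rep_limit sX hs) => k.
have [|y -> e'] := @mxpow_lie (fun y => y = x) X (eps R k)%:C x (2 ^ k) sX _ erefl.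
  by move=> y ->; rewrite ex0 scaler0 add0r.
by rewrite mul1mx.
Qed.

(** E_kk is, up to a scalar matrix, - i times an element X of su_n that is
    diagonal; exp(tX) is then diagonal and fixes v, so X kills v. *)
Lemma lie_diag_fixed v k : fixed_by rho (@SU_diag R n) v -> e (delta_mx k k) v = 0.
Proof.
move=> fv; pose lam (j : 'I_n) : R := (j == k)%:R - n%:R^-1.
have n0 : n%:R != 0 :> R by rewrite pnatr_eq0 -lt0n.
have lam0 : \sum_j lam j = 0.
  rewrite sumrB; have -> : \sum_(j < n) (n%:R^-1 : R) = 1.
    by rewrite sumr_const card_ord -(mulr_natl n%:R^-1) divff.
  by rewrite (bigD1 k) //= eqxx big1 ?addr0 ?subrr // => j /negPf->.
have u1 : (1%:M : 'M[R[i]]_n) \is unitarymx.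
  by apply/unitarymxP; rewrite trmx1 map_mx1 mulmx1.
have [s [hs sE]] := exp_seq_udiag u1 lam0; set X := udiag _ _ in hs.
have udiag1E c : udiag (1%:M : 'M[R[i]]_n) c = diagd c.
  by rewrite /udiag trmx1 map_mx1 mul1mx mulmx1.
have sX : su X by exact: su_udiag_imag.
have DXv : D X *m coords v = 0.
  have j1 := jetM (hD.1 _ sX _ hs.2) (jet_cst (coords v)).
  have j2 : jet (fun k => r (s k) *m coords v) (1%:M *m coords v) 0.
    apply: (@jet_ext _ _ _ (fun=> coords v)); last by rewrite mul1mx; apply: jet_cst.
    move=> j; rewrite rep_mxE fv // /SU_diag /= sE udiag1E.
    exact: diag_mx_is_diag.
  by have := jet_uniq j1 j2; rewrite mulmx0 add0r.
have -> : delta_mx k k = - J *: X + (n%:R^-1)%:M :> 'M[R[i]]_n.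
  rewrite /X udiag1E; apply/matrixP => a b; rewrite !mxE.
  have [<-|ab] := eqVneq a b; last first.
    rewrite mulr0n mulr0 add0r; case: (a =P k) => [ak|_] //=.
    by case: (b =P k) => [bk|_] //=; rewrite ak bk eqxx in ab.
  rewrite andbb !mulr1n /lam.
  have -> : (a == k)%:R = (((a == k)%:R : R)%:C : R[i]) by rewrite rmorph_nat.
  have -> : (n%:R^-1 : R[i]) = (n%:R^-1 : R)%:C by rewrite fmorphV rmorph_nat.
  by apply/eqP; rewrite eq_complex /=; apply/andP; split; apply/eqP; ring.
apply: (can_inj (@coordsK _ V)).
rewrite coords_lie (cdiffD n_gt0 rM hD) (cdiff_scalar n_gt0 rM hD).
rewrite (cdiffZ n_gt0 rM hD) (cdiff_su rM hD sX) addr0 -scalemxAl DXv scaler0.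
by rewrite coords0.
Qed.

(** A transposition matrix has determinant -1; changing the sign of one row puts
    it in SU_n without changing its action on diagonal matrices. *)
Lemma signed_transposition (a b : 'I_n) : exists g : SU R n, forall k,
  g *m delta_mx k k *m g^t* = delta_mx (tperm a b k) (tperm a b k).
Proof.
have [<-|ab] := eqVneq a b.
  by exists 1%g => k; rewrite /= trmx1 map_mx1 mulmx1 mul1mx tperm1 perm1.
pose s (k : 'I_n) : R[i] := if k == a then -1 else 1.
pose A : 'M[R[i]]_n := diagd s *m perm_mx (tperm a b).
have ss : diagd s *m (diagd s)^t* = 1%:M.
  rewrite diagd_adj diagdM -diagd1; congr diagd; apply/funext => k; rewrite /s.
  by case: eqP => _; rewrite ?rmorphN1 ?rmorph1 ?mulr1 // mulrNN mulr1.
have adjP : (perm_mx (tperm a b) : 'M[R[i]]_n)^t* = perm_mx (tperm a b).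
  by rewrite tr_perm_mx tpermV map_perm_mx.
have PP : perm_mx (tperm a b) *m perm_mx (tperm a b) = 1%:M :> 'M[R[i]]_n.
  by rewrite -perm_mxM tperm2 perm_mx1.
have AP : (A \is unitarymx) && (\det A == 1).
  apply/andP; split.
    apply/unitarymxP; rewrite /A trmx_mul map_mxM adjP -!mulmxA (mulmxA (perm_mx _)) PP.
    by rewrite mul1mx ss.
  rewrite /A det_mulmx det_perm odd_tperm ab expr1 det_diag (bigD1 a) //= big1.
    by rewrite mxE /s eqxx mulr1 mulrNN mulr1.
  by move=> k /negPf ka; rewrite mxE /s ka.
exists (MkSU AP) => k; rewrite /= /A trmx_mul map_mxM adjP.
have PE : perm_mx (tperm a b) *m delta_mx k k *m perm_mx (tperm a b)
    = delta_mx (tperm a b k) (tperm a b k) :> 'M[R[i]]_n.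
  rewrite -row_permE -{2}[tperm a b]tpermV -col_permE.
  apply/matrixP => i j; rewrite !mxE -!(can2_eq (tpermK a b) (tpermK a b)).
  by rewrite ?tpermV.
rewrite -!mulmxA (mulmxA (delta_mx k k)) (mulmxA (perm_mx _)) (mulmxA (perm_mx _)) PE.
set t := tperm a b k; rewrite -[X in _ *m X]/(delta_mx t t *m (diagd s)^t*).
have DE : diagd s *m delta_mx t t = s t *: delta_mx t t.
  apply/matrixP => i j; rewrite /diagd mul_diag_mx !mxE.
  by have [->//|] := eqVneq i t; rewrite /= !mulr0.
have ED : delta_mx t t *m (diagd s)^t* = ((s t)^*)%R *: delta_mx t t.
  rewrite diagd_adj; apply/matrixP => i j; rewrite /diagd mul_mx_diag !mxE.
  have [->|] := eqVneq j t; first by rewrite mulrC.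
  by rewrite andbF /= mul0r mulr0.
rewrite ED -scalemxAr DE scalerA.
have -> : ((s t)^*)%R * s t = 1.
  by rewrite /s; case: eqP => _; rewrite ?rmorphN1 ?rmorph1 ?mulr1 // mulrNN mulr1.
by rewrite scale1r.
Qed.

End LieActionOfRep.

(** * From Lie intertwiners to group intertwiners *)

Lemma jet_eq (R : realType) m n (u v : nat -> 'M[R[i]]_(m, n)) P Q X Y :
  jet u P X -> (forall k, u k = v k) -> P = Q -> X = Y -> jet v Q Y.
Proof. by move=> ju uv <- <-; apply: jet_ext ju. Qed.

Section Conjugation.
Variables (R : realType) (n : nat).
Implicit Types A B X : 'M[R[i]]_n.

(** Matrices as column vectors, so that X |-> A X B becomes a matrix. *)
Definition cvec X : 'cV[R[i]]_(n * n) := (mxvec X)^T.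

Definition sandwich :=
  locked (fun A B : 'M[R[i]]_n => (lin_mulmx A *m lin_mulmxr B)^T : 'M[R[i]]_(n * n)).

Lemma sandwich_def A B : sandwich A B = (lin_mulmx A *m lin_mulmxr B)^T.
Proof. by rewrite /sandwich -lock. Qed.

Lemma sandwichE A B X : sandwich A B *m cvec X = cvec (A *m X *m B).
Proof. by rewrite sandwich_def /cvec -trmx_mul mulmxA !mul_vec_lin. Qed.

Lemma cvec_linear (a : R[i]) X Y : cvec (a *: X + Y) = a *: cvec X + cvec Y.
Proof. by rewrite /cvec !linearP. Qed.

Lemma cvec_inj : injective cvec.
Proof. by move=> X Y /trmx_inj/(can_inj mxvecK). Qed.

Lemma cvec_ext (M N : 'M[R[i]]_(n * n)) :
  (forall X, M *m cvec X = N *m cvec X) -> M = N.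
Proof.
move=> h; apply/trmx_inj/row_matrixP => i; rewrite -!tr_col !colE; congr trmx.
have -> : delta_mx i 0 = cvec (vec_mx (delta_mx 0 i)); last exact: h.
by rewrite /cvec vec_mxK trmx_delta.
Qed.

(** The adjoint representation, as a matrix representation. *)
Definition conj_rep (g : SU R n) := sandwich g (g^t*).

Lemma conj_rep1 : conj_rep 1%g = 1%:M.
Proof.
by apply: cvec_ext => X; rewrite sandwichE /= trmx1 map_mx1 mulmx1 !mul1mx.
Qed.

Lemma conj_repM (g h : SU R n) : conj_rep (g * h)%g = conj_rep g *m conj_rep h.
Proof.
apply: cvec_ext => X; rewrite -mulmxA /conj_rep !sandwichE; congr cvec.
by rewrite /= trmx_mul map_mxM !mulmxA.
Qed.

Lemma jet_conj_rep (s : nat -> SU R n) X : su X -> exp_seq s X ->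
  jet (fun k => conj_rep (s k)) 1%:M (sandwich X 1%:M - sandwich 1%:M X).
Proof.
move=> sX [_ sj].
have j1 := jetM (jet_linear (@lin_mulmx _ n n n) sj)
                (jet_linear (@lin_mulmxr _ n n n) (jet_adj sj)).
have j2 := jet_linear (@trmx _ (n * n) (n * n)) j1.
apply: (jet_eq j2) => [k||].
- by rewrite /conj_rep sandwich_def.
- by rewrite -conj_rep1 /conj_rep sandwich_def.
- rewrite !sandwich_def sX.1 trmx1 map_mx1 linearN mulmxN addrC.
  by rewrite linearB.
Qed.

End Conjugation.

Section Intertwiner.
Variables (R : realType) (n : nat) (V : vectType R[i]) (rho : representation (SU R n) V).
Hypothesis n_gt0 : (0 < n)%N.
Local Notation d := (\dim (fullv : {vspace V})).
Local Notation r := (rep_mx rho).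
Variable D : 'M[R[i]]_n -> 'M[R[i]]_d.
Hypothesis hD : differential r D.
Local Notation e := (lie_of_rep n_gt0 hD).

(** By rep_approx on both sides: phi intertwines the approximations
    (1 + 2^-k D(X))^(2^k) and (1 + 2^-k ad X)^(2^k). *)
Lemma group_intertwine (phi : V -> 'M[R[i]]_n) : linear phi ->
  (forall A x, phi (e A x) = A *m phi x - phi x *m A) ->
  forall (g : SU R n) x, phi (rho g x) = g *m phi x *m g^t*.
Proof.
move=> lphi phiE g x; have [X [s [sX hs gE]]] := exp_seq_onto g n_gt0.
have lc : linear (fun y => cvec (phi y)) by move=> a y z; rewrite lphi cvec_linear.
pose P := mx_of (fun y => cvec (phi y)).
pose DA : 'M[R[i]]_(n * n) := sandwich X 1%:M - sandwich 1%:M X.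
have PE y : P *m coords y = cvec (phi y) by exact: mx_ofE.
have PD : P *m D X = DA *m P.
  apply: mx_coords_inj => y; rewrite -!mulmxA PE mulmxBl !sandwichE mulmx1 mul1mx.
  have -> : D X *m coords y = coords (e X y) by rewrite coords_lie (cdiff_su (rep_mxM rho) hD).
  by rewrite PE phiE /cvec !linearB.
have [C1 [k1 h1]] := rep_approx (rep_mx1 rho) (rep_mxM rho) hs (hD.1 _ sX _ hs.2).
have [C2 [k2 h2]] := rep_approx (@conj_rep1 R n) (@conj_repM R n) hs (jet_conj_rep sX hs).
have key : P *m r g = conj_rep g *m P.
  rewrite -gE; apply/eqP; rewrite -subr_eq0; apply/eqP/mxnorm_eq0/eqP.
  rewrite eq_le mxnorm_ge0 andbT.
  apply: (@le_eps0 _ _ (mxnorm P * C1 + C2 * mxnorm P) (maxn k1 k2)) => k.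
  rewrite geq_max => /andP[/h1 {}h1 /h2 {}h2].
  set B1 := mxpow _ _ in h1; set B2 := mxpow _ _ in h2.
  have PB : P *m B1 = B2 *m P.
    apply: mxpow_intertwine.
    by rewrite mulmxDr mulmxDl mulmx1 mul1mx -scalemxAr -scalemxAl PD.
  have -> : P *m r (s 0%N) - conj_rep (s 0%N) *m P =
      P *m (r (s 0%N) - B1) - (conj_rep (s 0%N) - B2) *m P.
    by rewrite mulmxBr mulmxBl PB opprB addrA subrK.
  apply: le_trans (mxnormB _ _) _; rewrite mulrDl lerD //.
    by apply: le_trans (mxnormM _ _) _; rewrite -mulrA ler_wpM2l ?mxnorm_ge0.
  by apply: le_trans (mxnormM _ _) _; rewrite mulrAC ler_wpM2r ?mxnorm_ge0.
apply: cvec_inj; rewrite -PE -rep_mxE mulmxA key -(mulmxA (conj_rep g)) (PE x).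
exact: sandwichE.
Qed.

End Intertwiner.

(** * The isospectral model and the classification *)

Section ComplexifiedHermitian.
Variables (R : realType) (n : nat).
Hypothesis n_gt0 : (0 < n)%N.
Local Notation J := (iC R).
Local Notation sk := (@skew_part R n).
Implicit Types (A X : 'M[R[i]]_n) (H : Her0 R n).

Let JJ A : J *: (J *: A) = - A. Proof. by rewrite scalerA iCM scaleN1r. Qed.

Lemma her0_of_su X : su X -> - (J *: X) \in @her0_pred R n.
Proof.
move=> [aX tX]; rewrite unfold_in.
have -> : \tr (- (J *: X)) = 0 by rewrite raddfN /= linearZ /= tX mulr0 oppr0.
rewrite eqxx andbT.
by apply/hermP; rewrite linearN /= map_mxN adjZ conj_iC aX scaleNr scalerN opprK.
Qed.

Lemma su_of_her0 H : su (J *: Her0_mx H).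
Proof.
case: H => H /= /andP[/hermP aH /eqP tH]; split; last by rewrite linearZ /= tH mulr0.
by rewrite adjZ conj_iC aH scaleNr.
Qed.

(** The Hermitian traceless part, written through the skew-Hermitian part of iA. *)
Definition herm_part A : Her0 R n := MkHer0 (her0_of_su (skew_part_su n_gt0 (J *: A))).

Lemma herm_partD A B : herm_part (A + B) = herm_part A + herm_part B.
Proof. by apply/val_inj; rewrite /= scalerDr skew_partD scalerDr opprD. Qed.

Lemma herm_partZ (c : R) A : herm_part (c%:C *: A) = c *: herm_part A.
Proof.
apply/val_inj => /=.
have -> : J *: (c%:C *: A) = c%:C *: (J *: A) by rewrite !scalerA mulrC.
by rewrite skew_partZ scalerN !scalerA mulrC.
Qed.

Lemma herm_partN A : herm_part (- A) = - herm_part A.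
Proof. by apply/val_inj; rewrite /= scalerN skew_partN scalerN. Qed.

Lemma herm_part_id H : herm_part H = H.
Proof. by apply/val_inj; rewrite /= skew_part_id ?JJ ?opprK //; apply: su_of_her0. Qed.

Lemma herm_part_J H : herm_part (J *: Her0_mx H) = 0.
Proof.
apply/val_inj; rewrite /= skew_part_iC ?scaler0 ?oppr0 //; exact: su_of_her0.
Qed.

Lemma herm_part_conj (g : SU R n) A :
  herm_part (g *m A *m g^t*) = isospectral R n g (herm_part A).
Proof.
apply/val_inj => /=; have -> : J *: (g *m A *m g^t*) = g *m (J *: A) *m g^t*.
  by rewrite -scalemxAr -scalemxAl.
by rewrite skew_part_conj mulmxN mulNmx -scalemxAr -scalemxAl.
Qed.

Lemma herm_part_recompose A : \tr A = 0 ->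
  A = Her0_mx (herm_part A) + J *: Her0_mx (herm_part (- (J *: A))).
Proof.
move=> trA; have JNJ (B : 'M[R[i]]_n) : J *: (- (J *: B)) = B by rewrite scalerN JJ opprK.
rewrite {1}(skew_decomposition A) trA mul0r raddf0 addr0 /= !JNJ addrC.
by rewrite skew_partN scalerN.
Qed.

(** The decomposition A = H + iH' of a traceless matrix with H and H' Hermitian. *)
Definition to_complexification A : complexification (Her0 R n) :=
  (herm_part A, herm_part (- (J *: A))).

Lemma to_complexification_linear : linear to_complexification.
Proof.
(* z = Re z + i Im z acts on pairs by the formula that defines the complexification. *)
have Zp (z : R[i]) A : to_complexification (z *: A) = z *: to_complexification A.
  have zE := complex_split z; congr pair.
    rewrite {1}zE scalerDl herm_partD herm_partZ -scalerA.
    have -> : J *: ((complex.Im z)%:C *: A) = (complex.Im z)%:C *: - (- (J *: A)).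
      by rewrite opprK !scalerA mulrC.
    by rewrite herm_partZ herm_partN scalerN.
  have -> : - (J *: (z *: A)) =
      (complex.Re z)%:C *: - (J *: A) + (complex.Im z)%:C *: A.
    rewrite {1}zE scalerDl scalerDr opprD -!scalerA JJ; congr (_ + _).
      by rewrite scalerN !scalerA mulrC.
    by rewrite opprK.
  by rewrite herm_partD !herm_partZ.
move=> z A B; rewrite -Zp; congr pair; first exact: herm_partD.
by rewrite scalerDr opprD herm_partD.
Qed.

Lemma to_complexification_act (g : SU R n) A :
  to_complexification (g *m A *m g^t*) =
  complexify (isospectral R n) g (to_complexification A).
Proof.
congr pair; first exact: herm_part_conj.
rewrite -[in RHS]herm_part_conj; congr herm_part.
by rewrite mulmxN mulNmx -scalemxAr -scalemxAl.
Qed.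

Lemma to_complexification_inj A : \tr A = 0 -> to_complexification A = 0 -> A = 0.
Proof.
move=> trA h; have h1 : herm_part A = 0 by exact: (congr1 fst h).
have h2 : herm_part (- (J *: A)) = 0 by exact: (congr1 snd h).
by rewrite (herm_part_recompose trA) h1 h2 scaler0 addr0.
Qed.

Lemma to_complexification_onto u : exists2 A, \tr A = 0 & to_complexification A = u.
Proof.
case: u => H1 H2; exists (Her0_mx H1 + J *: Her0_mx H2).
  case: H1 H2 => [H1 /andP[_ /eqP t1]] [H2 /andP[_ /eqP t2]] /=.
  by rewrite linearD linearZ /= t1 t2 mulr0 addr0.
congr pair; first by rewrite herm_partD herm_part_id herm_part_J addr0.
have -> : - (J *: (Her0_mx H1 + J *: Her0_mx H2)) = Her0_mx H2 - J *: Her0_mx H1.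
  by rewrite scalerDr JJ opprD opprK addrC.
by rewrite herm_partD herm_partN herm_part_id herm_part_J oppr0 addr0.
Qed.

Lemma rep_iso_isospectral (V : vectType R[i]) (rho : representation (SU R n) V)
    (phi : V -> 'M[R[i]]_n) :
  linear phi -> (forall x, phi x = 0 -> x = 0) -> (forall x, \tr (phi x) = 0) ->
  (forall A, \tr A = 0 -> exists x, phi x = A) ->
  (forall (g : SU R n) x, phi (rho g x) = g *m phi x *m g^t*) ->
  rep_iso rho (complexify (isospectral R n)).
Proof.
move=> lphi phi0 phitr phionto phiG; pose f x := to_complexification (phi x).
have lf : linear f by move=> a x y; rewrite /f lphi to_complexification_linear.
pose f' := GRing.isLinear.Build _ _ _ _ f lf.
pose F : {linear V -> complexification (Her0 R n)} := HB.pack f f'.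
exists F; split; last by move=> g x; rewrite /= /f phiG to_complexification_act.
have Fonto u : exists x, F x = u.
  have [A trA <-] := to_complexification_onto u.
  by have [x <-] := phionto A trA; exists x.
have [G FG] := choice Fonto; exists G => // x.
apply/eqP; rewrite -subr_eq0; apply/eqP/phi0/to_complexification_inj => //.
by rewrite -[LHS]/(F (G (F x) - x)) linearB FG subrr.
Qed.

End ComplexifiedHermitian.

Section ActLinear.
Variables (G : groupType) (K : pzRingType) (V : lmodType K) (rho : representation G V).

Lemma act_zero g : rho g 0 = 0.
Proof.
have := act_linear rho g 1 0 0; rewrite !scale1r addr0 => /eqP.
by rewrite eq_sym -subr_eq0 addrK => /eqP.
Qed.

Lemma act_scale g c x : rho g (c *: x) = c *: rho g x.
Proof. by have := act_linear rho g c x 0; rewrite act_zero !addr0. Qed.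

End ActLinear.

Lemma rep_iso_trivial (G : groupType) (K : fieldType) (V : vectType K)
    (rho : representation G V) (v : V) :
  irreducible rho -> v != 0 -> (forall g, rho g v = v) ->
  rep_iso rho (trivial_rep G K).
Proof.
move=> [_ irr] v0 fv.
have rhoZ g c : rho g (c *: v) = c *: v by rewrite act_scale fv.
have lineT : <[v]>%VS = fullv :> {vspace V}.
  have [g x /vlineP[c ->]|l0|//] := irr <[v]>%VS.
    by rewrite rhoZ memvZ ?memv_line.
  by move: v0; rewrite -memv0 -l0 memv_line.
have inj c c' : c *: v = c' *: v -> c = c'.
  move/eqP; rewrite -subr_eq0 -scalerBl scaler_eq0 (negPf v0) orbF subr_eq0.
  by move/eqP.
have /choice[f fE] : forall x : V, exists c : K, x = c *: v.
  move=> x; have /vlineP[c ->] : x \in <[v]>%VS by rewrite lineT memvf.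
  by exists c.
have lf : linear (f : V -> K^o).
  by move=> a x y; apply: inj; rewrite -fE scalerDl -scalerA -!fE.
pose f' := GRing.isLinear.Build _ _ _ _ f lf.
pose F : {linear V -> K^o} := HB.pack f f'.
exists F; split=> [|g x]; last by rewrite /= {1}(fE x) rhoZ -fE.
exists (fun c => c *: v) => [x|c]; first by rewrite /= -fE.
by apply: inj; rewrite /= -fE.
Qed.

Theorem proposition3p2 (R : realType) (n : nat) (hn : (2 <= n)%N)
    (V : vectType R[i]) (rho : representation (SU R n) V)
    (rho_cont : continuous_rep rho) (rho_irr : irreducible rho)
    (hdim : (\dim (fullv : {vspace V}) <= n ^ 2 - 1)%N)
    (hfix : exists v : V, v != 0 /\ fixed_by rho (@SU_diag R n) v) :
  rep_iso rho (trivial_rep (SU R n) R[i]) \/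
  rep_iso rho (complexify (isospectral R n)).
Proof.
case: n hn V rho rho_cont rho_irr hdim hfix => [|[|m]] // hn.
move=> V rho rho_cont rho_irr hdim [v [v0 fv]].
have n_gt0 : (0 < m.+2)%N by [].
have [D hD] := exists_differential (rep_mx1 rho) (rep_mxM rho) (rep_mx_continuous rho_cont).
pose e := lie_of_rep n_gt0 hD.
have e1 x : e 1%:M x = 0 by apply: lie_scalar.
have irr (U : {vspace V}) : (forall A x, x \in U -> e A x \in U) -> U = 0%VS \/ U = fullv.
  move=> stabU; apply: rho_irr.2 => g x; exact: stable_of_lie_stable stabU g x.
have swap (i j : 'I_m.+2) : exists S : V -> V,
    [/\ forall x, S x = 0 -> x = 0, forall c x, S (c *: x) = c *: S x
    & forall k x, e (delta_mx (tperm i j k) (tperm i j k)) (S x) = S (e (delta_mx k k) x)].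
  have [g hg] := signed_transposition R i j; exists (rho g); split.
  - by move=> x gx0; rewrite -[x](act1 rho) -(mulVg g) actM gx0 act_zero.
  - by move=> c x; apply: act_scale.
  - by move=> k x; rewrite -hg; apply: lie_conj.
have wv : weight e 0 v by move=> k; rewrite ffunE scale0r; apply: lie_diag_fixed.
have [kill|[phi [lphi phi0 phitr phionto phiE]]] :=
  small_zero_weight_classification e1 irr hdim swap v0 wv.
  by left; apply: (rep_iso_trivial rho_irr v0); apply: fixed_of_lie_killed kill.
right; apply: (rep_iso_isospectral n_gt0 lphi phi0 phitr phionto).
exact: group_intertwine lphi phiE.
Qed.
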